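(* Let $\lambda,\mu\in\mathbb{K}$. Then $\dim\mathrm{H}^1_{\mathrm{diff}}(\mathcal{K}(1);\mathfrak{D}_{\lambda,\mu})=1$ if one of the following holds: \begin{itemize} \item $\mu-\lambda=0$ (for all $\lambda$); \item $\mu-\lambda=\frac32$ (for all $\lambda$); \item $\mu-\lambda=2$ (for all $\lambda$); \item $\mu-\lambda=\frac52$ (for all $\lambda$); \item $\mu-\lambda=3$ and $\lambda\in\{0,-\frac52\}$; \item $\mu-\lambda=4$ and $\lambda=\frac{-7\pm\sqrt{33}}{4}$. \end{itemize} Moreover $\dim\mathrm{H}^1_{\mathrm{diff}}(\mathcal{K}(1);\mathfrak{D}_{0,\frac12})=2$. Otherwise, $\mathrm{H}^1_{\mathrm{diff}}(\mathcal{K}(1);\mathfrak{D}_{\lambda,\mu})=0$. The spaces $\mathrm{H}^1_{\mathrm{diff}}(\mathcal{K}(1);\mathfrak{D}_{\lambda,\mu})$ are spanned by the cohomology classes of the 1-cocycles $\Upsilon_{\lambda,\lambda+\frac32}$ ($\lambda\ne-\frac12$), $\Upsilon_{\lambda,\lambda+2}$ (all $\lambda$), $\Upsilon_{\lambda,\lambda+\frac52}$ ($\lambda\neq-1$), $\Upsilon_{\lambda,\lambda+3}$ ($\lambda=0,-\frac52$), $\Upsilon_{\lambda,\lambda+4}$ ($\lambda=\frac{-7\pm\sqrt{33}}4$) given in the context, and by the classes of the following 1-cocycles: \begin{align*} \Upsilon_{\lambda,\lambda}(X_G)(F\alpha^\lambda)&=G'F\alpha^\lambda,\\ \Upsilon_{0,\frac12}(X_G)(F)&=\overline\eta(G')F\,\alpha^{\frac12},\\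 \widetilde\Upsilon_{0,\frac12}(X_G)(F)&=\overline\eta(G'F)\,\alpha^{\frac12},\\ \Upsilon_{-\frac12,1}(X_G)(F\alpha^{-\frac12})&=\Big(\overline\eta(G'')F+\overline\eta(G')F'+(-1)^{p(G)}G''\overline\eta(F)\Big)\alpha,\\ \Upsilon_{-1,\frac32}(X_G)(F\alpha^{-1})&=\Big((-1)^{p(G)}\big(G'''\overline\eta(F)+2G''\overline\eta(F')\big)+2\overline\eta(G'')F'+\overline\eta(G')F''\Big)\alpha^{\frac32}. \end{align*}
   Context: Let $\mathbb{K}=\mathbb{R}$ or $\mathbb{C}$ and let $\mathbb{K}[x,\theta]$ be the superalgebra of polynomials in an even variable $x$ and an odd variable $\theta$ ($\theta^2=0$); $p(\cdot)$ denotes parity, $F'=\partial_xF$, $F^{(i)}=\partial_x^iF$. Put $\overline{\eta}=\partial_\theta-\theta\partial_x$ (so $\overline\eta^2=-\partial_x$). The Lie superalgebra $\mathcal{K}(1)$ of contact polynomial vector fields (those preserving the distribution singled out by $\alpha=dx+\theta d\theta$) is spanned by $X_F=F\partial_x-\frac12(-1)^{p(F)}\overline\eta(F)\overline\eta$, $F\in\mathbb{K}[x,\theta]$, with $[X_F,X_G]=X_{\{F,G\}}$, $\{F,G\}=FG'-F'G-\frac12(-1)^{p(F)}\overline\eta(F)\overline\eta(G)$. For $\lambda\in\mathbb{K}$, $\mathfrak{F}_\lambda=\{F\alpha^\lambda\mid F\in\mathbb{K}[x,\theta]\}$ is the $\mathcal{K}(1)$-module with action $\mathfrak{L}^\lambda_{X_F}=X_F+\lambda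 F'$. $\mathfrak{D}_{\lambda,\mu}$ is the space of linear differential operators $A$, viewed as maps $\mathfrak{F}_\lambda\to\mathfrak{F}_\mu$, $F\alpha^\lambda\mapsto A(F)\alpha^\mu$, with action $X_F\cdot A=\mathfrak{L}^{\lambda,\mu}_{X_F}(A)=\mathfrak{L}^\mu_{X_F}\circ A-(-1)^{p(A)p(F)}A\circ\mathfrak{L}^\lambda_{X_F}$. Differential cohomology: only cochains given by differential operators (in the coefficient functions of the vector fields and in the argument of the density) are considered. For $v\in\mathfrak D_{\lambda,\mu}$, $\delta v(g)=(-1)^{p(g)p(v)}g\cdot v$; for a 1-cochain $\Upsilon:\mathcal K(1)\to\mathfrak D_{\lambda,\mu}$, $\delta(\Upsilon)(g,h)=(-1)^{p(g)p(\Upsilon)}g\cdot\Upsilon(h)-(-1)^{p(h)(p(g)+p(\Upsilon))}h\cdot\Upsilon(g)-\Upsilon([g,h])$. $\mathrm H^1_{\mathrm{diff}}(\mathcal K(1);\mathfrak D_{\lambda,\mu})=\ker\delta/\mathrm{im}\,\delta$ in degree 1 (even and odd cochains together). The cocycles referred to in the claim are \begin{align*} \Upsilon_{\lambda,\lambda+\frac32}(X_G)(F\alpha^\lambda)&=\overline\eta(G'')F\,\alpha^{\lambda+\frac32},\\ \Upsilon_{\lambda,\lambda+2}(X_G)(F\alpha^\lambda)&=\Big(\tfrac23\lambda G^{(3)}F-(-1)^{p(G)}\overline\eta(G'')\overline\eta(F)\Big)\alpha^{\lambda+2},\\ \Upsilon_{\lambda,\lambda+\frac52}(X_G)(F\alpha^\lambda)&=\Big(2\lambda\overline\eta(G^{(3)})F-3\overline\eta(G'')F'-(-1)^{p(G)}G^{(3)}\overline\eta(F)\Big)\alpha^{\lambda+\frac52},\\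 \Upsilon_{\lambda,\lambda+3}(X_G)(F\alpha^\lambda)&=\Big((-1)^{p(G)}\overline\eta(G'')\overline\eta(F')-\tfrac{2\lambda+1}{3}\big((-1)^{p(G)}\overline\eta(G^{(3)})\overline\eta(F)+G^{(3)}F'\big)+\tfrac{\lambda(2\lambda+1)}{6}G^{(4)}F\Big)\alpha^{\lambda+3},\\ \Upsilon_{\lambda,\lambda+4}(X_G)(F\alpha^\lambda)&=\Big((-1)^{p(G)}\overline\eta(G'')\overline\eta(F'')-\tfrac{2(\lambda+1)}{3}\big(2(-1)^{p(G)}\overline\eta(G^{(3)})\overline\eta(F')+G^{(3)}F''\big)\\ &\quad+\tfrac{(\lambda+1)(2\lambda+1)}{6}\big((-1)^{p(G)}\overline\eta(G^{(4)})\overline\eta(F)+2G^{(4)}F'\big)-\tfrac{\lambda(\lambda+1)(2\lambda+1)}{15}G^{(5)}F\Big)\alpha^{\lambda+4}. \end{align*} *)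

(* Defs.v *)
From HB Require Import structures.
From mathcomp Require Import all_boot all_order all_algebra.
From mathcomp Require Import reals complex.

Set Implicit Arguments.
Unset Strict Implicit.
Unset Printing Implicit Defensive.

Import Order.TTheory GRing.Theory Num.Theory.
Local Open Scope ring_scope.

Inductive ground := RealGround | ComplexGround.

Definition ground_field (R : realType) (k : ground) : numFieldType :=
  match k with
  | RealGround => R
  | ComplexGround => R[i]
  end.

Definition sqrt33 (R : realType) (k : ground) : ground_field R k :=
  match k return ground_field R k with
  | RealGround => Num.sqrt (33 : R)
  | ComplexGround => (Num.sqrt (33 : R))%:C%C
  end.

(* The pair (f0, f1) stands for f0 + f1 * theta.  It gets the product of
   K[x, theta] with theta^2 = 0, not the componentwise product of pairs. *)
Definition superpoly (K : fieldType) : Type := ({poly K} * {poly K})%type.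

HB.instance Definition _ (K : fieldType) :=
  GRing.Lmodule.copy (superpoly K) ({poly K} * {poly K})%type.

Section SuperpolyRing.
Variable K : fieldType.
Implicit Types F G H : superpoly K.

Definition sp_one : superpoly K := (1, 0).

Definition sp_mul F G : superpoly K := (F.1 * G.1, F.1 * G.2 + F.2 * G.1).

Fact sp_mulA : associative sp_mul.
Proof.
by move=> F G H; rewrite /sp_mul /= !mulrDr !mulrDl !mulrA addrA.
Qed.

Fact sp_mulC : commutative sp_mul.
Proof.
move=> F G; rewrite /sp_mul [F.1 * G.1]mulrC addrC.
by rewrite [F.1 * G.2]mulrC [F.2 * G.1]mulrC.
Qed.

Fact sp_mul1 : left_id sp_one sp_mul.
Proof. by case=> f g; rewrite /sp_mul /= !mul1r mul0r addr0. Qed.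

Fact sp_mulDl : left_distributive sp_mul +%R.
Proof. by move=> F G H; rewrite /sp_mul /= !mulrDl addrACA. Qed.

Fact sp_one_neq0 : sp_one != 0.
Proof. by apply/eqP => -[] /eqP; rewrite oner_eq0. Qed.

HB.instance Definition _ :=
  GRing.Zmodule_isComNzRing.Build (superpoly K)
    sp_mulA sp_mulC sp_mul1 sp_mulDl sp_one_neq0.

End SuperpolyRing.

Section ContactCohomology.
Variable K : fieldType.
Implicit Types (F G H : superpoly K) (p q r : bool).

Definition theta : superpoly K := (0, 1).
Definition dx F : superpoly K := (F.1^`(), F.2^`()).
Definition dxn (i : nat) F : superpoly K := iter i dx F.
Definition dtheta F : superpoly K := (F.2, 0).
Definition etabar F : superpoly K := dtheta F - theta * dx F.

(* Parities are booleans, true being odd, so that they add with (+).  A formula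
   which involves the parity of its arguments is extended by multilinearity,
   through the homogeneous components of these arguments. *)
Definition hpart p F : superpoly K := if p then (0, F.2) else (F.1, 0).

(* Equal to (-1)^p(F) F for F homogeneous. *)
Definition psign F : superpoly K := \sum_(p : bool) (-1) ^+ p *: hpart p F.

(* The operator X_F.  Since F |-> X_F is injective, K(1) is K[x,theta] with the
   bracket {F, G}. *)
Definition vfield F G : superpoly K :=
  F * dx G - 2^-1 *: (etabar (psign F) * etabar G).

Definition contact_bracket F G : superpoly K :=
  F * dx G - dx F * G - 2^-1 *: (etabar (psign F) * etabar G).

Definition lie_density (lambda : K) F G : superpoly K :=
  vfield F G + lambda *: (dx F * G).

(* Elements of F_lambda and F_mu are represented by their coefficients with
   respect to alpha^lambda and alpha^mu. *)
Definition operator := superpoly K -> superpoly K.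

Definition is_diffop (A : operator) : Prop :=
  exists (n : nat) (a : 'I_n -> bool -> superpoly K),
    forall F, A F = \sum_(i < n) \sum_(e : bool) a i e * dxn i (iter e dtheta F).

Definition op_part q (A : operator) : operator :=
  fun F => \sum_(p : bool) hpart (p (+) q) (A (hpart p F)).

(* X_G . A for G homogeneous of parity p and A homogeneous of parity q. *)
Definition op_action (lambda mu : K) p q G (A : operator) : operator :=
  fun F => lie_density mu G (A F)
           - (-1) ^+ (q && p) *: A (lie_density lambda G F).

(* 1-cochains: X_G is represented by G. *)
Definition cochain := superpoly K -> operator.

Definition is_diffcochain (U : cochain) : Prop :=
  exists (n : nat) (a : 'I_n -> bool -> 'I_n -> bool -> superpoly K),
    forall G F,
      U G F = \sum_(i < n) \sum_(e : bool) \sum_(j < n) \sum_(f : bool)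
                a i e j f * (dxn i (iter e dtheta G) * dxn j (iter f dtheta F)).

Definition cochain_part r (U : cochain) : cochain :=
  fun G F => \sum_(p : bool) op_part (p (+) r) (U (hpart p G)) F.

Definition delta0 (lambda mu : K) (v : operator) : cochain :=
  fun G F => \sum_(p : bool) \sum_(q : bool)
    (-1) ^+ (p && q) *: op_action lambda mu p q (hpart p G) (op_part q v) F.

Definition delta1 (lambda mu : K) (U : cochain) G H : operator :=
  fun F => \sum_(p : bool) \sum_(q : bool) \sum_(r : bool)
    let g := hpart p G in
    let h := hpart q H in
    let Ur := cochain_part r U in
    ((-1) ^+ (p && r) *: op_action lambda mu p (q (+) r) g (Ur h) F
     - (-1) ^+ (q && (p (+) r)) *: op_action lambda mu q (p (+) r) h (Ur g) F
     - Ur (contact_bracket g h) F).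

Definition is_cocycle (lambda mu : K) (U : cochain) : Prop :=
  is_diffcochain U /\ forall G H F, delta1 lambda mu U G H F = 0.

Definition is_coboundary (lambda mu : K) (U : cochain) : Prop :=
  exists2 v, is_diffop v & forall G F, U G F = delta0 lambda mu v G F.

Definition lincomb n (c : 'I_n -> K) (Y : 'I_n -> cochain) : cochain :=
  fun G F => \sum_(i < n) c i *: Y i G F.

Definition H1_spanned (lambda mu : K) n (Y : 'I_n -> cochain) : Prop :=
  (forall i, is_cocycle lambda mu (Y i)) /\
  (forall U, is_cocycle lambda mu U ->
     exists c : 'I_n -> K,
       is_coboundary lambda mu (fun G F => U G F - lincomb c Y G F)).

Definition H1_free (lambda mu : K) n (Y : 'I_n -> cochain) : Prop :=
  forall c : 'I_n -> K,
    is_coboundary lambda mu (lincomb c Y) -> forall i, c i = 0.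

Definition H1_dim (lambda mu : K) (n : nat) : Prop :=
  exists Y : 'I_n -> cochain, H1_spanned lambda mu Y /\ H1_free lambda mu Y.

(* In these formulas a sign (-1)^p(G) is written as psign applied to G inside
   the differential operator; dx commutes with psign, but etabar does not.
   Ups32s and Ups52s are only meant for lambda = -1/2 and lambda = -1, where
   Ups32 and Ups52 lambda are coboundaries. *)
Definition Ups0 : cochain := fun G F => dx G * F.

Definition Ups12 : cochain := fun G F => etabar (dx G) * F.

Definition Ups12t : cochain := fun G F => etabar (dx G * F).

Definition Ups32 : cochain := fun G F => etabar (dxn 2 G) * F.

Definition Ups32s : cochain := fun G F =>
  etabar (dxn 2 G) * F + etabar (dx G) * dx F + dxn 2 (psign G) * etabar F.

Definition Ups2 (lambda : K) : cochain := fun G F =>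
  (2 / 3 * lambda) *: (dxn 3 G * F) - etabar (dxn 2 (psign G)) * etabar F.

Definition Ups52 (lambda : K) : cochain := fun G F =>
  (2 * lambda) *: (etabar (dxn 3 G) * F) - 3 *: (etabar (dxn 2 G) * dx F)
  - dxn 3 (psign G) * etabar F.

Definition Ups52s : cochain := fun G F =>
  dxn 3 (psign G) * etabar F + 2 *: (dxn 2 (psign G) * etabar (dx F))
  + 2 *: (etabar (dxn 2 G) * dx F) + etabar (dx G) * dxn 2 F.

Definition Ups3 (lambda : K) : cochain := fun G F =>
  etabar (dxn 2 (psign G)) * etabar (dx F)
  - ((2 * lambda + 1) / 3) *:
      (etabar (dxn 3 (psign G)) * etabar F + dxn 3 G * dx F)
  + (lambda * (2 * lambda + 1) / 6) *: (dxn 4 G * F).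

Definition Ups4 (lambda : K) : cochain := fun G F =>
  etabar (dxn 2 (psign G)) * etabar (dxn 2 F)
  - (2 * (lambda + 1) / 3) *:
      (2 *: (etabar (dxn 3 (psign G)) * etabar (dx F)) + dxn 3 G * dxn 2 F)
  + ((lambda + 1) * (2 * lambda + 1) / 6) *:
      (etabar (dxn 4 (psign G)) * etabar F + 2 *: (dxn 4 G * dx F))
  - (lambda * (lambda + 1) * (2 * lambda + 1) / 15) *: (dxn 5 G * F).

End ContactCohomology.

Arguments Ups0 {K}.
Arguments Ups12 {K}.
Arguments Ups12t {K}.
Arguments Ups32 {K}.
Arguments Ups32s {K}.
Arguments Ups52s {K}.

(* Main.v *)
(** Composing the component of parity r of a cochain with psign^r turns the
    super-commutators into plain ones, so that even and odd cochains are treated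
    at once; etabar then becomes the operator zeta : (f0, f1) |-> (f1, f0'),
    which is a square root of d/dx and commutes with the action of X_1 and
    X_theta.

    Subtracting coboundaries, one makes a cocycle V vanish on X_1 and X_theta.
    It is then invariant under zeta, hence determined by the scalars
      gam p f i k = value at 0 of V (theta^p x^i) (theta^f x^k).
    The cocycle condition with X_x lets one remove all weights but one, so that
    these scalars vanish unless 2 (i + k) + p + f = d + 2, where
    d = 2 (mu - lambda) must be a natural number.  The remaining cocycle
    conditions are linear recurrences, which determine everything from the
    values at G = x, theta x and theta x^2.  The first one vanishes unless
    zeta^d is invariant, i.e., d = 0 or d = 1 and lambda = 0; the coboundary of
    zeta^d cancels one of the two others; and for d >= 6 the recurrences at
    (theta x^2, theta x^2) and (theta x^3, theta x^3) leave only the exceptional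
    values of lambda. *)

Require Import Defs.
From HB Require Import structures.
From mathcomp Require Import all_boot all_order all_algebra.
From mathcomp Require Import reals complex.
From mathcomp Require Import ring zify.
From mathcomp Require boolp.

Set Implicit Arguments.
Unset Strict Implicit.
Unset Printing Implicit Defensive.

Import Order.TTheory GRing.Theory Num.Theory.
Local Open Scope ring_scope.

(** Three generators suffice because of the brackets with theta x: {theta x, theta x^n} = x^(n+1) /
    2 and {theta x, x^n} = (n/2 - 1) theta x^n reach every higher monomial, except that the second
    coefficient vanishes at n = 2. This is why theta x^2 remains a datum of its own beside x and
    theta x. At a fixed weight each of the three data is a single scalar, so the whole problem is
    finite dimensional for each d. The coboundary of zeta^d is nonzero at theta x when d > 0 is
    even. When d = 2 j + 1, its value there is a multiple of j + 2 lambda, and the case lambda = - j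
    / 2 has to be treated apart: zeta^d then cancels the value at theta x^2, and the value at theta
    x is what may survive. For j = 1 and j = 2 it does survive, which is the origin of [Ups32s] and
    [Ups52s]; from j = 3 on it is obstructed. For j = 0 both values of the coboundary disappear when
    lambda = 0, which leaves two classes. *)

(** * Polynomial identities reduced to field identities *)

Section Jets.
Variable K : numFieldType.
Implicit Types (g h : {poly K}).

(** In characteristic zero the points 0, 1, 2, ... are distinct, so a nonzero difference would have
    more roots than its size allows. *)
Lemma poly_horner_inj g h : (forall x, g.[x] = h.[x]) -> g = h.
Proof.
move=> e; apply/eqP; rewrite -subr_eq0; apply/eqP.
pose s := [seq (i%:R : K) | i <- iota 0 (size (g - h))].
apply: (@roots_geq_poly_eq0 _ _ s).
- by apply/allP => x _; rewrite rootE hornerD hornerN e subrr.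
- rewrite map_inj_uniq ?iota_uniq // => a b /eqP; rewrite eqr_nat.
  by move/eqP.
- by rewrite size_map size_iota.
Qed.

(** The derivatives of a product from those of its factors, without binomial coefficients: at a
    concrete order this unfolds to plain sums of products. *)
Fixpoint leibniz n (a b : nat -> K) : K :=
  if n is n'.+1 then
    leibniz n' (fun i => a i.+1) b + leibniz n' a (fun i => b i.+1)
  else a 0%N * b 0%N.

Definition jet (z : K) g : nat -> K := fun n => g^`(n).[z].

Lemma jet_deriv z g : jet z g^`() = fun n => jet z g n.+1.
Proof. by apply/boolp.funext => n; rewrite /jet derivSn. Qed.

Lemma jetM z g h : jet z (g * h) = fun n => leibniz n (jet z g) (jet z h).
Proof.
apply/boolp.funext => n; elim: n g h => [|n IHn] g h.
  by rewrite /jet !derivn0 hornerM.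
by rewrite {1}/jet derivSn derivM derivnD hornerD -!/(jet z _ n) !IHn !jet_deriv.
Qed.

(* Differential-polynomial identities are reflected: evaluating at each point
   turns them into field identities between finitely many jet coordinates. *)
Inductive pexpr :=
  | PAtom of {poly K} | PZero | PDeriv of pexpr | POpp of pexpr
  | PAdd of pexpr & pexpr | PMul of pexpr & pexpr | PScale of K & pexpr.

Fixpoint peval e : {poly K} :=
  match e with
  | PAtom g => g
  | PZero => 0
  | PDeriv e => (peval e)^`()
  | POpp e => - peval e
  | PAdd e1 e2 => peval e1 + peval e2
  | PMul e1 e2 => peval e1 * peval e2
  | PScale c e => c *: peval e
  end.

Fixpoint pjet z e : nat -> K :=
  match e with
  | PAtom g => jet z g
  | PZero => fun=> 0
  | PDeriv e => fun n => pjet z e n.+1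
  | POpp e => fun n => - pjet z e n
  | PAdd e1 e2 => fun n => pjet z e1 n + pjet z e2 n
  | PMul e1 e2 => fun n => leibniz n (pjet z e1) (pjet z e2)
  | PScale c e => fun n => c * pjet z e n
  end.

Lemma pjetE z e : pjet z e = jet z (peval e).
Proof.
elim: e => //= [|e ->|e ->|e1 -> e2 ->|e1 -> e2 ->|c e ->].
- by apply/boolp.funext => n; rewrite /jet linear0 horner0.
- by rewrite jet_deriv.
- by apply/boolp.funext => n; rewrite /jet derivnN hornerN.
- by apply/boolp.funext => n; rewrite /jet derivnD hornerD.
- by rewrite jetM.
- by apply/boolp.funext => n; rewrite /jet derivnZ hornerZ.
Qed.

Lemma pexprP e1 e2 : (forall z, pjet z e1 0 = pjet z e2 0) -> peval e1 = peval e2.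
Proof. by move=> h; apply: poly_horner_inj => z; move: (h z); rewrite !pjetE. Qed.

End Jets.

Ltac pquote t :=
  lazymatch t with
  | @GRing.add _ ?a ?b => let a' := pquote a in let b' := pquote b in
                          constr:(PAdd a' b')
  | @GRing.mul _ ?a ?b => let a' := pquote a in let b' := pquote b in
                          constr:(PMul a' b')
  | @GRing.opp _ ?a => let a' := pquote a in constr:(POpp a')
  | @GRing.scale _ _ ?c ?a => let a' := pquote a in constr:(PScale c a')
  | @deriv _ ?a => let a' := pquote a in constr:(PDeriv a')
  | @GRing.zero _ =>
    lazymatch goal with K : numFieldType |- _ => constr:(PZero K) end
  | ?a => constr:(PAtom a)
  end.

Ltac pjets :=
  rewrite /dx /=;
  lazymatch goal with |- ?a = ?b =>
    let a' := pquote a in let b' := pquote b in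
    change (peval a' = peval b')
  end;
  apply: pexprP => z; cbn [pjet leibniz];
  (* Each jet becomes an arbitrary sequence, whose entries are atoms for [field]. *)
  repeat match goal with |- context [@jet ?R ?x ?p] =>
    generalize (@jet R x p); intro end.

Ltac polyid := pjets; by field.

(** * Homogeneous components and the action on densities *)

Section Superpolynomials.
Variable K : numFieldType.
Implicit Types (F G H W : superpoly K) (g h k : {poly K}) (p q f : bool).

Definition sp p g : superpoly K := if p then (0, g) else (g, 0).
Definition component p F : {poly K} := if p then F.2 else F.1.

Lemma spE F : F = sp false F.1 + sp true F.2.
Proof. by case: F => a b; congr pair; rewrite /= ?addr0 ?add0r. Qed.

Lemma sp0 p : sp p 0 = 0. Proof. by case: p. Qed.
Lemma spD p g h : sp p (g + h) = sp p g + sp p h.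
Proof. by case: p; congr pair; rewrite /= ?addr0. Qed.
Lemma spN p g : sp p (- g) = - sp p g.
Proof. by case: p; congr pair; rewrite /= ?oppr0. Qed.
Lemma spZ p (c : K) g : sp p (c *: g) = c *: sp p g.
Proof. by case: p; congr pair; rewrite /= ?scaler0. Qed.
Lemma hpartE p F : hpart p F = sp p (component p F). Proof. by case: p. Qed.
Lemma hpart_sp p q g : hpart p (sp q g) = if p (+) q then 0 else sp q g.
Proof. by case: p; case: q. Qed.

Definition zeta F : superpoly K := (F.2, F.1^`()).

(** The only nonzero component of the action of a homogeneous field on a homogeneous density (see
    [lie_sp]). It brings identities between superpolynomials down to ordinary polynomials. *)
Definition lie_poly (l : K) p q g h : {poly K} :=
  if p then if q then 2^-1 *: (g * h) else 2^-1 *: (g * h^`()) + l *: (g^`() * h)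
  else g * h^`() + (l + (if q then 2^-1 else 0)) *: (g^`() * h).

Lemma half2 : 2^-1 + 2^-1 = 1 :> K. Proof. by field. Qed.

Lemma spMl F G : F * G = (F.1 * G.1, F.1 * G.2 + F.2 * G.1).
Proof. by []. Qed.

Lemma etabarE F : etabar F = (F.2, - F.1^`()).
Proof.
case: F => a b; rewrite /etabar spMl /= !mul0r mul1r add0r.
by congr pair; rewrite /= ?oppr0 ?addr0 ?add0r.
Qed.

Lemma psignE F : psign F = (F.1, - F.2).
Proof.
by case: F => a b; rewrite /psign big_bool /= expr1 expr0 scaleN1r scale1r;
  congr pair; rewrite /= ?oppr0 ?addr0 ?add0r.
Qed.

Lemma lie_densityE l F G : lie_density l F G =
  (F.1 * G.1^`() + 2^-1 *: (F.2 * G.2) + l *: (F.1^`() * G.1),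
   F.1 * G.2^`() + F.2 * G.1^`() +
   2^-1 *: (F.1^`() * G.2 - F.2 * G.1^`()) +
   l *: (F.1^`() * G.2 + F.2^`() * G.1)).
Proof.
rewrite /lie_density /vfield !etabarE psignE !spMl; congr pair; polyid.
Qed.

Lemma lie_sp l p q g h : lie_density l (sp p g) (sp q h) = sp (p (+) q) (lie_poly l p q g h).
Proof.
by case: p; case: q; rewrite lie_densityE /lie_poly /=; congr pair; polyid.
Qed.

(** The adjoint module is the module of densities of weight -1, so the formulas for densities serve
    for brackets as well. *)
Lemma bracketE F G : contact_bracket F G = lie_density (-1) F G.
Proof.
by rewrite lie_densityE /contact_bracket !etabarE psignE !spMl; congr pair; polyid.
Qed.

Lemma bracket_sp p q g h :
  contact_bracket (sp p g) (sp q h) = sp (p (+) q) (lie_poly (- 1) p q g h).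
Proof. by rewrite bracketE lie_sp. Qed.

End Superpolynomials.

(** * Differential operators and cochains *)

Section DifferentialOperators.
Variable K : numFieldType.
Implicit Types (F G H W : superpoly K) (A B : operator K) (U V : cochain K).

Definition lin A := forall (c : K) F G, A (c *: F + G) = c *: A F + A G.

Definition bilin U := (forall G, lin (U G)) /\ (forall F, lin (U ^~ F)).

Section Lin.
Variables (A : operator K) (linA : lin A).

Lemma lin0 : A 0 = 0.
Proof. by have := linA (-1) 0 0; rewrite scaler0 addr0 scaleN1r addNr. Qed.

Lemma linD F G : A (F + G) = A F + A G.
Proof. by have := linA 1 F G; rewrite !scale1r. Qed.

Lemma linZ c F : A (c *: F) = c *: A F.
Proof. by have := linA c F 0; rewrite !addr0 lin0 addr0. Qed.

Lemma linN F : A (- F) = - A F.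
Proof. by rewrite -scaleN1r linZ scaleN1r. Qed.

Lemma lin_sumr n (F : 'I_n -> superpoly K) : A (\sum_(i < n) F i) = \sum_(i < n) A (F i).
Proof. by apply: (big_morph A); [exact: linD | exact: lin0]. Qed.

End Lin.

Lemma lin_comp A B : lin A -> lin B -> lin (fun F => A (B F)).
Proof. by move=> hA hB c F G; rewrite hB hA. Qed.
Lemma lin_add A B : lin A -> lin B -> lin (fun F => A F + B F).
Proof. by move=> hA hB c F G; rewrite hA hB scalerDr addrACA. Qed.
Lemma lin_scale c A : lin A -> lin (fun F => c *: A F).
Proof. by move=> hA d F G; rewrite hA scalerDr !scalerA mulrC. Qed.
Lemma lin_opp A : lin A -> lin (fun F => - A F).
Proof. by move=> hA c F G; rewrite hA opprD scalerN. Qed.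
Lemma lin_sum (I : Type) (r : seq I) (P : pred I) (A : I -> operator K) :
  (forall i, lin (A i)) -> lin (fun F => \sum_(i <- r | P i) A i F).
Proof.
by move=> hA c F G; rewrite scaler_sumr -big_split; apply: eq_bigr => i _; rewrite hA.
Qed.
Lemma spZAl (c : K) F G : (c *: F : superpoly K) * G = c *: (F * G).
Proof.
rewrite !spMl; apply: (_ : _ = (c *: (F.1 * G.1), c *: (F.1 * G.2 + F.2 * G.1))).
by congr pair; rewrite /= ?scalerDr !scalerAl ?scalerAr.
Qed.
Lemma spZAr (c : K) F G : F * (c *: G : superpoly K) = c *: (F * G).
Proof. by rewrite mulrC spZAl mulrC. Qed.
Lemma lin_mul W : lin ( *%R W).
Proof. by move=> c F G; rewrite mulrDr spZAr. Qed.
Lemma lin_mulr W : lin (fun F => F * W).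
Proof. by move=> c F G; rewrite mulrDl spZAl. Qed.
Lemma lin_dx : lin (@dx K).
Proof. by move=> c F G; rewrite /dx; congr pair; rewrite /= derivD derivZ. Qed.
Lemma lin_dtheta : lin (@dtheta K).
Proof. by move=> c F G; rewrite /dtheta; congr pair; rewrite /= scaler0 addr0. Qed.
Lemma lin_hpart p : lin (@hpart K p).
Proof.
by move=> c F G; rewrite /hpart; case: p; congr pair; rewrite /= ?scaler0 ?addr0.
Qed.
Lemma lin_psign : lin (@psign K).
Proof.
by move=> c F G; rewrite !psignE; congr pair; rewrite //= opprD scalerN.
Qed.
Lemma lin_etabar : lin (@etabar K).
Proof.
by move=> c F G; rewrite !etabarE; congr pair; rewrite //= derivD derivZ opprD scalerN.
Qed.
Lemma lin_zeta : lin (@zeta K).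
Proof.
by move=> c F G; rewrite /zeta; congr pair; rewrite //= derivD derivZ.
Qed.

Lemma lin_lier l G : lin (lie_density l G).
Proof.
apply: lin_add; last by apply: lin_scale; apply: lin_mul.
apply: lin_add; first by apply: (lin_comp (lin_mul G)); exact: lin_dx.
by apply: lin_opp; apply: lin_scale; apply: (lin_comp (lin_mul _)); exact: lin_etabar.
Qed.
Lemma lin_liel l F : lin (lie_density l ^~ F).
Proof.
apply: lin_add; last first.
  by apply: lin_scale; apply: (lin_comp (lin_mulr _)); exact: lin_dx.
apply: lin_add; first exact: lin_mulr.
apply: lin_opp; apply: lin_scale; apply: (lin_comp (lin_mulr _)).
exact: (lin_comp lin_etabar lin_psign).
Qed.

Lemma dxM F G : dx (F * G) = dx F * G + F * dx G.
Proof. by rewrite !spMl; congr pair; rewrite /= ?derivD !derivM // addrACA. Qed.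
Lemma dthetaM F G : dtheta (F * G) = dtheta F * G + psign F * dtheta G.
Proof.
by rewrite !spMl psignE; congr pair; rewrite /=; ring.
Qed.
Definition dmon (i : nat) (e : bool) F := dxn i (iter e (@dtheta K) F).

Lemma dxnE n F : dxn n F = (F.1^`(n), F.2^`(n)).
Proof. by elim: n => [|n IHn]; [case: F | rewrite /= IHn]. Qed.

Lemma dmonE i e F : dmon i e F = if e then (F.2^`(i), 0) else (F.1^`(i), F.2^`(i)).
Proof. by case: e; rewrite /dmon dxnE //= linear0. Qed.

Lemma lin_dxn n : lin (@dxn K n).
Proof. by elim: n => [|n IHn] //; apply: (lin_comp lin_dx). Qed.

Lemma lin_dmon i e : lin (dmon i e).
Proof. by apply: (lin_comp (@lin_dxn i)); case: e => //; exact: lin_dtheta. Qed.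

Lemma diffop_ext A B : A =1 B -> is_diffop B -> is_diffop A.
Proof. by move=> e [n [a h]]; exists n, a => F; rewrite e h. Qed.

Lemma diffop_lin A : is_diffop A -> lin A.
Proof.
case=> n [a h] c F G; rewrite !h; move: c F G.
apply: lin_sum => i; apply: lin_sum => e; apply: (lin_comp (lin_mul _)).
exact: lin_dmon.
Qed.

Lemma sum_widen (V : nmodType) n N (f : nat -> V) : (n <= N)%N ->
  (forall i, (n <= i)%N -> f i = 0) -> \sum_(i < N) f i = \sum_(i < n) f i.
Proof.
move=> le h; rewrite (big_ord_widen _ _ le) [RHS]big_mkcond /=.
by apply: eq_bigr => i _; case: ltnP => // /h.
Qed.

Definition ord_extend n (V : nmodType) (a : 'I_n -> V) (i : nat) : V :=
  if insub i is Some j then a j else 0.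

Lemma ord_extendE n (V : nmodType) (a : 'I_n -> V) (i : 'I_n) : ord_extend a i = a i.
Proof. by rewrite /ord_extend valK. Qed.
Lemma ord_extend0 n (V : nmodType) (a : 'I_n -> V) i : (n <= i)%N -> ord_extend a i = 0.
Proof. by move=> h; rewrite /ord_extend insubN // -leqNgt. Qed.

(** Padding the coefficients with zeros lets two operators share one bound on the order, as sums
    require. *)
Lemma diffopW A : is_diffop A -> exists n (a : nat -> bool -> superpoly K),
  forall N F, (n <= N)%N -> A F = \sum_(i < N) \sum_(e : bool) a i e * dmon i e F.
Proof.
case=> n [a h]; exists n, (fun i e => ord_extend (a ^~ e) i) => N F le.
rewrite (@sum_widen _ n N (fun i => \sum_e ord_extend (a ^~ e) i * dmon i e F)) //.
  by rewrite h; apply: eq_bigr => i _; apply: eq_bigr => e _; rewrite ord_extendE.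
by move=> i ni; rewrite big1 // => e _; rewrite ord_extend0 // mul0r.
Qed.

Lemma diffop_mul W A : is_diffop A -> is_diffop (fun F => W * A F).
Proof.
case=> n [a h]; exists n, (fun i e => W * a i e) => F; rewrite h mulr_sumr.
by apply: eq_bigr => i _; rewrite mulr_sumr; apply: eq_bigr => e _; rewrite mulrA.
Qed.

Lemma diffop_add A B : is_diffop A -> is_diffop B -> is_diffop (fun F => A F + B F).
Proof.
move=> /diffopW[n [a hA]] /diffopW[m [b hB]].
exists (n + m)%N, (fun i e => a i e + b i e) => F.
rewrite (hA (n + m)%N) ?leq_addr // (hB (n + m)%N) ?leq_addl // -big_split.
apply: eq_bigr => i _; rewrite -big_split; apply: eq_bigr => e _.
by rewrite mulrDl.
Qed.

Lemma diffop0 : is_diffop (fun=> 0 : superpoly K).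
Proof. by exists 0%N, (fun _ _ => 0) => F; rewrite big_ord0. Qed.

Lemma diffop_sum (I : Type) (r : seq I) (P : pred I) (A : I -> operator K) :
  (forall i, is_diffop (A i)) -> is_diffop (fun F => \sum_(i <- r | P i) A i F).
Proof.
move=> h; elim: r => [|i r IHr].
  by apply: diffop_ext diffop0 => F; rewrite big_nil.
case Pi : (P i).
  by apply: diffop_ext (diffop_add (h i) IHr) => F; rewrite big_cons Pi.
by apply: diffop_ext IHr => F; rewrite big_cons Pi.
Qed.

Lemma diffop_scale c A : is_diffop A -> is_diffop (fun F => c *: A F).
Proof.
by move=> h; apply: diffop_ext (diffop_mul (c *: sp_one K) h) => F; rewrite spZAl;
  congr (_ *: _); rewrite -[LHS]mul1r.
Qed.

Lemma diffop_opp A : is_diffop A -> is_diffop (fun F => - A F).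
Proof.
by move=> h; apply: diffop_ext (diffop_scale (-1) h) => F; rewrite scaleN1r.
Qed.

Lemma diffop_sub A B : is_diffop A -> is_diffop B -> is_diffop (fun F => A F - B F).
Proof. by move=> hA hB; apply: diffop_add => //; apply: diffop_opp. Qed.

Lemma diffop_dmon i e : is_diffop (dmon i e).
Proof.
exists i.+1, (fun k f => ((k == i :> nat) && (f == e))%:R) => F.
rewrite (bigD1 ord_max) //= [X in _ + X]big1 ?addr0; last first.
  move=> k /negP nk; rewrite big1 // => f _; case: eqP => [ki|_]; last by rewrite mul0r.
  by case: nk; apply/eqP/val_inj.
rewrite (bigD1 e) //= !eqxx mul1r big1 ?addr0 // => f /negPf ->.
by rewrite andbF mul0r.
Qed.

Lemma diffop_id : is_diffop (@id (superpoly K)).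
Proof. exact: (diffop_dmon 0 false). Qed.

Lemma diffop_comp A B : is_diffop A -> is_diffop B -> is_diffop (fun F => A (B F)).
Proof.
have comp_dx C : is_diffop C -> is_diffop (fun F => dx (C F)).
  case=> n [a h]; apply: (@diffop_ext _ (fun F => \sum_(i < n) \sum_e
      (dx (a i e) * dmon i e F + a i e * dmon i.+1 e F))).
    move=> F; rewrite h (lin_sumr lin_dx); apply: eq_bigr => i _.
    by rewrite !big_bool /= (linD lin_dx) !dxM.
  apply: diffop_sum => i; apply: diffop_sum => e.
  by apply: diffop_add; apply: diffop_mul; exact: diffop_dmon.
have comp_dtheta C : is_diffop C -> is_diffop (fun F => dtheta (C F)).
  (* Since [dtheta] squares to zero, the second Leibniz term survives only for e = false, where it
     produces [dmon i true]. *)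
  case=> n [a h]; apply: (@diffop_ext _ (fun F => \sum_(i < n) \sum_e
      (dtheta (a i e) * dmon i e F + psign (a i e) * (~~ e)%:R * dmon i true F))).
    move=> F; rewrite h (lin_sumr lin_dtheta); apply: eq_bigr => i _.
    rewrite !big_bool /= (linD lin_dtheta) !dthetaM; congr (_ + _ + (_ + _)).
      by rewrite mulr0 mul0r -/(dmon i true F) dmonE /dtheta /= mulr0.
    by rewrite mulr1 -/(dmon i false F) !dmonE.
  apply: diffop_sum => i; apply: diffop_sum => e.
  by apply: diffop_add; apply: diffop_mul; exact: diffop_dmon.
case=> n [a h] hB.
apply: diffop_ext (_ : is_diffop (fun F => \sum_(i < n) \sum_e a i e * dmon i e (B F))) => //.
apply: diffop_sum => i; apply: diffop_sum => e; apply: diffop_mul.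
elim: (i : nat) => [|k]; last exact: comp_dx.
by case: e => //; apply: comp_dtheta.
Qed.

Lemma diffop_dx : is_diffop (@dx K). Proof. exact: (diffop_dmon 1 false). Qed.
Lemma diffop_dtheta : is_diffop (@dtheta K). Proof. exact: (diffop_dmon 0 true). Qed.
Lemma diffop_dxn n : is_diffop (@dxn K n). Proof. exact: (diffop_dmon n false). Qed.
Lemma diffop_etabar : is_diffop (@etabar K).
Proof.
exact: (diffop_sub diffop_dtheta (diffop_mul _ diffop_dx)).
Qed.
(** Multiplication by theta after [dtheta] is the projection to the odd part, so parity signs are
    differential operators too. *)
Lemma diffop_hpart p : is_diffop (@hpart K p).
Proof.
have e F : theta K * dtheta F = (0, F.2).
  by rewrite spMl; congr pair; rewrite /= ?mul0r ?mulr0 // add0r mul1r.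
have h1 : is_diffop (@hpart K true).
  by apply: diffop_ext (diffop_mul (theta K) diffop_dtheta) => F; rewrite e.
case: p => //; apply: diffop_ext (diffop_sub diffop_id h1) => F.
by case: F => a b; congr pair; rewrite /= ?subr0 ?subrr.
Qed.
Lemma diffop_psign : is_diffop (@psign K).
Proof. by apply: diffop_sum => p; apply: diffop_scale; exact: diffop_hpart. Qed.
Lemma diffop_zeta : is_diffop (@zeta K).
Proof.
apply: diffop_ext (diffop_comp diffop_psign diffop_etabar) => F.
by rewrite etabarE psignE /= opprK.
Qed.
Lemma diffop_lie l G : is_diffop (lie_density l G).
Proof.
apply: diffop_add; last by apply: diffop_scale; apply: diffop_mul; exact: diffop_id.
apply: diffop_sub; first by apply: diffop_mul; exact: diffop_dx.
by apply: diffop_scale; apply: diffop_mul; exact: diffop_etabar.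
Qed.

Lemma diffcochainP U : is_diffcochain U -> bilin U /\ forall G, is_diffop (U G).
Proof.
case=> n [a h]; split; [split=> X |] => [c F G|c F G|].
- rewrite !h; move: c F G; do 4! [apply: lin_sum => ?].
  by do 2! apply: (lin_comp (lin_mul _)); exact: lin_dmon.
- rewrite !h; move: c F G; do 4! [apply: lin_sum => ?].
  apply: (lin_comp (lin_mul _)); apply: (lin_comp (lin_mulr _)).
  exact: lin_dmon.
move=> G; apply: diffop_ext (h G) _.
do 4! [apply: diffop_sum => ?]; apply: diffop_mul; apply: diffop_mul.
exact: diffop_dmon.
Qed.

Lemma diffcochain_mul A B : is_diffop A -> is_diffop B ->
  is_diffcochain (fun G F => A G * B F).
Proof.
move=> /diffopW[n [a hA]] /diffopW[m [b hB]].
exists (n + m)%N, (fun i e j f => a i e * b j f) => G F.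
rewrite (hA (n + m)%N) ?leq_addr // (hB (n + m)%N) ?leq_addl // mulr_suml.
apply: eq_bigr => i _; rewrite mulr_suml; apply: eq_bigr => e _; rewrite mulr_sumr.
apply: eq_bigr => j _; rewrite mulr_sumr; apply: eq_bigr => f _.
by rewrite mulrACA.
Qed.

Lemma diffcochainW U : is_diffcochain U ->
  exists n (a : nat -> bool -> nat -> bool -> superpoly K),
  forall N G F, (n <= N)%N -> U G F = \sum_(i < N) \sum_(e : bool) \sum_(j < N)
    \sum_(f : bool) a i e j f * (dmon i e G * dmon j f F).
Proof.
case=> n [a h]; pose b i e j f := ord_extend (fun i => ord_extend (fun j => a i e j f) j) i.
exists n, b => N G F le; rewrite h.
have b0 i e j f : (n <= i)%N || (n <= j)%N -> b i e j f = 0.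
  rewrite /b /ord_extend; case: insubP => [i' _ <-|_ _] //; rewrite leqNgt ltn_ord /= => nj.
  by rewrite insubN // -leqNgt.
rewrite (@sum_widen _ n N (fun i => \sum_e \sum_(j < N) \sum_f
   b i e j f * (dmon i e G * dmon j f F))) //; last first.
  move=> i ni; do 3! [rewrite big1 // => ? _].
  by rewrite b0 ?ni // mul0r.
apply: eq_bigr => i _; apply: eq_bigr => e _.
rewrite (@sum_widen _ n N (fun j => \sum_f
   b i e j f * (dmon i e G * dmon j f F))) //; last first.
  move=> j nj; rewrite big1 // => ? _.
  by rewrite b0 ?nj ?orbT // mul0r.
by apply: eq_bigr => j _; apply: eq_bigr => f _; rewrite /b !ord_extendE.
Qed.

Lemma diffcochain_add U V : is_diffcochain U -> is_diffcochain V ->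
  is_diffcochain (fun G F => U G F + V G F).
Proof.
move=> /diffcochainW[n [a hA]] /diffcochainW[m [b hB]].
exists (n + m)%N, (fun i e j f => a i e j f + b i e j f) => G F.
rewrite (hA (n + m)%N) ?leq_addr // (hB (n + m)%N) ?leq_addl //.
by do 4! [rewrite -big_split; apply: eq_bigr => ? _]; rewrite mulrDl.
Qed.

Lemma diffcochain_scale c U : is_diffcochain U -> is_diffcochain (fun G F => c *: U G F).
Proof.
case=> n [a h]; exists n, (fun i e j f => c *: a i e j f) => G F; rewrite h.
by do 4! [rewrite scaler_sumr; apply: eq_bigr => ? _]; rewrite spZAl.
Qed.

Lemma diffcochain_opp U : is_diffcochain U -> is_diffcochain (fun G F => - U G F).
Proof.
move=> h; case: (diffcochain_scale (-1) h) => n [a e]; exists n, a => G F.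
by rewrite -e scaleN1r.
Qed.

End DifferentialOperators.

(** * Removing the signs *)

Section Twist.
Variable K : numFieldType.
Implicit Types (F G H W : superpoly K) (A B : operator K) (U V : cochain K).
Implicit Types (g h k : {poly K}) (p q f : bool) (l m : K).

Lemma sum_bool (V : nmodType) (u : bool -> V) : \sum_(b : bool) u b = u true + u false.
Proof. by rewrite big_bool. Qed.

(* On the component of parity b + r, this is psign^r. *)
Definition twist_sign (b : bool) W : superpoly K := if b then W else psign W.

Lemma twist_signK b : involutive (twist_sign b).
Proof. by case: b => // -[x y]; rewrite /= !psignE /= opprK. Qed.

Lemma psign0 : psign (0 : superpoly K) = 0.
Proof. exact: (lin0 (@lin_psign K)). Qed.

Lemma twist_sign0 b : twist_sign b 0 = 0.
Proof. by case: b; rewrite //= (lin0 (@lin_psign K)). Qed.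

Lemma twist_sign_eq0 b W : twist_sign b W = 0 -> W = 0.
Proof. by move=> h; rewrite -(twist_signK b W) h twist_sign0. Qed.

Lemma lin_twist_sign b : lin (twist_sign b).
Proof. by case: b => //; exact: lin_psign. Qed.

Lemma diffop_twist_sign b : is_diffop (twist_sign b).
Proof. by case: b; [exact: diffop_id | exact: diffop_psign]. Qed.

Definition twist U : cochain K := fun G F =>
  \sum_(p : bool) \sum_(f : bool) twist_sign (p (+) f) (U (hpart p G) (hpart f F)).

Definition twist_op A : operator K := fun F => \sum_(f : bool) twist_sign f (A (hpart f F)).

(** A plain commutator, whatever the parities of G and A. *)
Definition twisted_coboundary l m A : cochain K := fun G F =>
  lie_density m G (A F) - A (lie_density l G F).

(** The signs depend only on the parities of the two fields. For even cochains this is the original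
    condition; the twist brings odd cochains to the same one. *)
Definition delta l m V p q g h F : superpoly K :=
  lie_density m (sp p g) (V (sp q h) F)
  - (-1) ^+ (p && q) *: lie_density m (sp q h) (V (sp p g) F)
  + V (sp p g) (lie_density l (sp q h) F)
  - (-1) ^+ (p && q) *: V (sp q h) (lie_density l (sp p g) F)
  - V (contact_bracket (sp p g) (sp q h)) F.

Lemma bilin0l U F : bilin U -> U 0 F = 0.
Proof. by case=> _ h; rewrite (lin0 (h F)). Qed.
Lemma bilin0r U G : bilin U -> U G 0 = 0.
Proof. by case=> h _; rewrite (lin0 (h G)). Qed.

Lemma op_part_sp q A f g : lin A -> op_part q A (sp f g) = hpart (f (+) q) (A (sp f g)).
Proof.
move=> hA; rewrite /op_part sum_bool.
by case: f; rewrite !hpart_sp /= (lin0 hA) (lin0 (@lin_hpart K _)) ?addr0 ?add0r.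
Qed.

Lemma lin_op_part q A : lin A -> lin (op_part q A).
Proof.
move=> hA; apply: lin_sum => p; apply: (lin_comp (@lin_hpart K _)).
by apply: (lin_comp hA); apply: lin_hpart.
Qed.

Lemma cochain_part_sp r U p g F : bilin U ->
  cochain_part r U (sp p g) F = op_part (p (+) r) (U (sp p g)) F.
Proof.
move=> hU; rewrite /cochain_part sum_bool.
have z q : op_part q (U 0) F = 0.
  by rewrite /op_part big1 // => b _; rewrite bilin0l // (lin0 (@lin_hpart K _)).
by case: p; rewrite !hpart_sp /= z ?addr0 ?add0r.
Qed.

Lemma bilin_twist U : bilin U -> bilin (twist U).
Proof.
case=> h1 h2; split=> X; apply: lin_sum => p; apply: lin_sum => f;
  apply: (lin_comp (@lin_twist_sign _)).
- by apply: (lin_comp (h1 _)); apply: lin_hpart.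
- by apply: (lin_comp (h2 _)); apply: lin_hpart.
Qed.

Lemma twist_sp U p f g h : bilin U ->
  twist U (sp p g) (sp f h) = twist_sign (p (+) f) (U (sp p g) (sp f h)).
Proof.
move=> hU; rewrite /twist !sum_bool.
by case: p; case: f; rewrite !hpart_sp /= ?(bilin0l _ hU) ?(bilin0r _ hU)
  ?psign0 ?addr0 ?add0r.
Qed.

Lemma bilin_ext U V : bilin U -> bilin V ->
  (forall p f g h, U (sp p g) (sp f h) = V (sp p g) (sp f h)) ->
  forall G F, U G F = V G F.
Proof.
move=> [u1 u2] [v1 v2] e G F; rewrite (spE G) (spE F).
by rewrite !(linD (u2 _)) !(linD (u1 _)) !(linD (v2 _)) !(linD (v1 _)) !e.
Qed.

Lemma lin_ext A B : lin A -> lin B -> (forall f h, A (sp f h) = B (sp f h)) -> A =1 B.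
Proof. by move=> a b e F; rewrite (spE F) (linD a) (linD b) !e. Qed.

Lemma lin_twist_op A : lin A -> lin (twist_op A).
Proof.
move=> hA; apply: lin_sum => f; apply: (lin_comp (@lin_twist_sign _)).
by apply: (lin_comp hA); apply: lin_hpart.
Qed.

Lemma twist_op_sp A f g : lin A -> twist_op A (sp f g) = twist_sign f (A (sp f g)).
Proof.
move=> hA; rewrite /twist_op sum_bool.
by case: f; rewrite !hpart_sp /= (lin0 hA) ?psign0 ?addr0 ?add0r.
Qed.

Lemma twist_opK A : lin A -> twist_op (twist_op A) =1 A.
Proof.
move=> hA; apply: lin_ext => //; first by do 2! apply: lin_twist_op.
by move=> f h; rewrite !twist_op_sp //; [rewrite twist_signK | apply: lin_twist_op].
Qed.

Lemma diffop_twist_op A : is_diffop A -> is_diffop (twist_op A).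
Proof.
move=> hA; apply: diffop_sum => f; apply: (diffop_comp (diffop_twist_sign _)).
by apply: (diffop_comp hA); exact: diffop_hpart.
Qed.

Lemma diffop_twist U : (forall G, is_diffop (U G)) -> forall G, is_diffop (twist U G).
Proof.
move=> hU G; apply: diffop_sum => p; apply: diffop_sum => f.
apply: (diffop_comp (diffop_twist_sign _)); apply: (diffop_comp (hU _)).
exact: diffop_hpart.
Qed.

Lemma bilin_twisted_coboundary l m A : lin A -> bilin (twisted_coboundary l m A).
Proof.
move=> hA; split=> X; apply: lin_add.
- exact: (lin_comp (@lin_lier _ _ _) hA).
- by apply: lin_opp; apply: (lin_comp hA); exact: lin_lier.
- exact: lin_liel.
- by apply: lin_opp; apply: (lin_comp hA); exact: lin_liel.
Qed.

Lemma diffop_twisted_coboundary l m A : is_diffop A -> forall G,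
  is_diffop (twisted_coboundary l m A G).
Proof.
move=> hA G; apply: diffop_sub; apply: diffop_comp => //; exact: diffop_lie.
Qed.

Lemma bilin_delta0 l m A : lin A -> bilin (delta0 l m A).
Proof.
move=> hA; split=> X; apply: lin_sum => p; apply: lin_sum => q; apply: lin_scale;
  apply: lin_add; have hq := @lin_op_part q _ hA.
- exact: (lin_comp (@lin_lier _ _ _) hq).
- apply: lin_opp; apply: lin_scale; apply: (lin_comp hq); exact: lin_lier.
- exact: (lin_comp (@lin_liel _ _ _) (@lin_hpart _ _)).
- apply: lin_opp; apply: lin_scale; apply: (lin_comp hq).
  exact: (lin_comp (@lin_liel _ _ _) (@lin_hpart _ _)).
Qed.

Lemma lie_spl l p g W :
  lie_density l (sp p g) W = sp p (lie_poly l p false g W.1) + sp (~~ p) (lie_poly l p true g W.2).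
Proof. by rewrite {1}(spE W) (linD (@lin_lier _ _ _)) !lie_sp addbF addbT. Qed.

Lemma lie0l l F : lie_density l 0 F = 0.
Proof. exact: (lin0 (@lin_liel _ l F)). Qed.

Lemma delta0_sp l m A p f g h : lin A ->
  delta0 l m A (sp p g) (sp f h) = twist_sign (p (+) f) (twisted_coboundary l m (twist_op A)
    (sp p g) (sp f h)).
Proof.
move=> hA.
have zz q n c F : (-1) ^+ n *: op_action l m c q 0 (op_part q A) F = 0.
  rewrite /op_action !lie0l (lin0 (lin_op_part q hA)).
  by rewrite scaler0 subr0 scaler0.
rewrite /delta0 /twisted_coboundary lie_sp !twist_op_sp // !sum_bool.
set a := A _; set b := A _.
have t q : op_action l m p q (sp p g) (op_part q A) (sp f h) =
    sp (p (+) (f (+) q)) (lie_poly m p (f (+) q) g (component (f (+) q) a))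
    - (-1) ^+ (q && p) *: sp (p (+) f (+) q) (component (p (+) f (+) q) b).
  by rewrite /op_action lie_sp !op_part_sp // !hpartE lie_sp.
(* Only the components of the two values of A matter. Once these are arbitrary polynomials, each of
   the four parity cases is a differential-polynomial identity. *)
clearbody a b; case: a b t => [a0 a1] [b0 b1] t.
rewrite lie_spl; have := t true; have := t false => {t}.
have e F1 F2 : F1.1 = F2.1 -> F1.2 = F2.2 -> F1 = F2 :> superpoly K.
  by case: F1 F2 => [? ?] [? ?] /= -> ->.
case: p f => [] []; rewrite !hpart_sp /= => -> ->; rewrite !zz;
  apply: e; rewrite ?psignE /=; rewrite /lie_poly ?(expr0, expr1, scaleN1r, scale1r); polyid.
Qed.

Definition delta1_term l m U p q r G H F : superpoly K :=
  (-1) ^+ (p && r) *: op_action l m p (q (+) r) G (cochain_part r U H) F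
  - (-1) ^+ (q && (p (+) r)) *: op_action l m q (p (+) r) H (cochain_part r U G) F
  - cochain_part r U (contact_bracket G H) F.

Lemma lin_cochain_part r U G : bilin U -> lin (cochain_part r U G).
Proof. by move=> hU; apply: lin_sum => p; apply: lin_op_part; exact: hU.1. Qed.

Lemma lin_delta1_term l m U p q r G H : bilin U -> lin (delta1_term l m U p q r G H).
Proof.
move=> hU; have hc := @lin_cochain_part r U _ hU.
have ha a b X Y : lin (op_action l m a b X (cochain_part r U Y)).
  apply: lin_add; first exact: (lin_comp (@lin_lier _ _ _)).
  by apply: lin_opp; apply: lin_scale; apply: (lin_comp (hc _)); exact: lin_lier.
apply: lin_add; last exact: lin_opp.
by apply: lin_add; [|apply: lin_opp]; apply: lin_scale.
Qed.

Lemma lin_delta1 l m U G H : bilin U -> lin (delta1 l m U G H).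
Proof.
move=> hU; apply: lin_sum => p; apply: lin_sum => q; apply: lin_sum => r.
exact: lin_delta1_term.
Qed.

Lemma delta1_sp l m U p q g h F : bilin U -> delta1 l m U (sp p g) (sp q h) F =
  \sum_(r : bool) delta1_term l m U p q r (sp p g) (sp q h) F.
Proof.
move=> hU.
have c0 r X : cochain_part r U 0 X = 0.
  rewrite /cochain_part big1 // => b _; rewrite (lin0 (@lin_hpart K _)).
  by rewrite /op_part big1 // => c _; rewrite bilin0l // (lin0 (@lin_hpart K _)).
have T0l p' q' r X : delta1_term l m U p' q' r 0 X F = 0.
  rewrite /delta1_term /op_action !bracketE !lie0l !c0 (lin0 (lin_cochain_part _ _ hU)).
  by rewrite ?(lin0 (@lin_lier _ _ _)) ?scaler0 ?subr0 ?scaler0 ?subr0.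
have T0r p' q' r X : delta1_term l m U p' q' r X 0 F = 0.
  rewrite /delta1_term /op_action !bracketE !lie0l !c0 !(lin0 (@lin_lier _ _ _)).
  by rewrite !(lin0 (lin_cochain_part _ _ hU)) ?c0 ?scaler0 ?subr0 ?scaler0 ?subr0.
rewrite /delta1 -[LHS]/(\sum_p' \sum_q' \sum_r delta1_term l m U p' q' r
  (hpart p' (sp p g)) (hpart q' (sp q h)) F) !sum_bool.
by case: (p); case: (q); rewrite !hpart_sp; cbn [addb negb];
  rewrite ?T0l ?T0r ?addr0 ?add0r.
Qed.

Lemma delta1_homog l m U G H F : bilin U -> delta1 l m U G H F =
  \sum_(p : bool) \sum_(q : bool) delta1 l m U (sp p (component p G)) (sp q (component q H)) F.
Proof.
move=> hU; apply: eq_bigr => p _; apply: eq_bigr => q _; rewrite delta1_sp //.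
by rewrite !hpartE.
Qed.

(** This is what justifies the twist. The values of U become arbitrary pairs of polynomials, and the
    two sides are compared in the eight parity cases; both components of each value are kept, so
    even and odd parts of U are covered together. *)
Lemma deltaE U l m p q f g h k : bilin U ->
  delta l m (twist U) p q g h (sp f k) =
  twist_sign (p (+) q (+) f) (delta1 l m U (sp p g) (sp q h) (sp f k)).
Proof.
move=> hU.
have e F1 F2 : F1.1 = F2.1 -> F1.2 = F2.2 -> F1 = F2 :> superpoly K.
  by case: F1 F2 => [? ?] [? ?] /= -> ->.
rewrite delta1_sp // sum_bool.
rewrite /delta /delta1_term /op_action !bracket_sp !lie_sp !cochain_part_sp // !op_part_sp
  ?(hU.1) //.
rewrite !twist_sp // !hpartE !lie_sp !lie_spl.
case: (U (sp q h) (sp f k)) => a0 a1; case: (U (sp p g) (sp f k)) => b0 b1.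
case: (U (sp p g) (sp (q (+) f) _)) => c1 c2.
case: (U (sp q h) (sp (p (+) f) _)) => d0 d1.
case: (U (sp (p (+) q) _) (sp f k)) => e0 e1.
case: p q f => [] [] [] /=; apply: e; rewrite ?psignE /=;
  rewrite /lie_poly ?(expr0, expr1, scaleN1r, scale1r).
all: first [exact: hU.1 | polyid].
Qed.

Lemma lin_delta l m V p q g h : bilin V -> lin (delta l m V p q g h).
Proof.
case=> hV _; have hl := @lin_lier K.
apply: lin_add; last exact/lin_opp.
apply: lin_add; last by apply/lin_opp/lin_scale/(lin_comp (hV _)).
apply: lin_add; last exact: (lin_comp (hV _)).
by apply: lin_add; [|apply/lin_opp/lin_scale]; apply: (lin_comp (hl _ _)).
Qed.

Lemma cocycle_twist l m U : is_diffcochain U -> (is_cocycle l m U <->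
  forall p q g h F, delta l m (twist U) p q g h F = 0).
Proof.
move=> hU; have [bU _] := diffcochainP hU; split=> [[_ h] p q g k|h].
  apply: (lin_ext (B := fun=> 0)); [exact/lin_delta/bilin_twist | |].
    by move=> c F G; rewrite scaler0 addr0.
  by move=> f x; rewrite deltaE // h twist_sign0.
split=> // G H; apply: (lin_ext (B := fun=> 0)); first exact: lin_delta1.
  by move=> c F X; rewrite scaler0 addr0.
move=> f x; rewrite delta1_homog // big1 // => p _; rewrite big1 // => q _.
by apply: (@twist_sign_eq0 (p (+) q (+) f)); rewrite -deltaE // h.
Qed.

Lemma coboundary_twist l m U A : bilin U -> is_diffop A ->
  (forall G F, twist U G F = twisted_coboundary l m A G F) -> is_coboundary l m U.
Proof.
move=> hU dA h; have lA := diffop_lin dA.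
exists (twist_op A); first exact: diffop_twist_op.
apply: bilin_ext => //; first by apply: bilin_delta0; exact: lin_twist_op.
move=> p f x y; rewrite delta0_sp; last exact: lin_twist_op.
apply: (can_inj (twist_signK (p (+) f))); rewrite twist_signK -twist_sp // h /twisted_coboundary.
by rewrite !twist_opK.
Qed.

Lemma twist_coboundary l m U : is_coboundary l m U -> exists2 A, lin A &
  forall G F, twist U G F = twisted_coboundary l m A G F.
Proof.
case=> A dA h; have lA := diffop_lin dA; exists (twist_op A); first exact: lin_twist_op.
have bU : bilin U.
  by case: (bilin_delta0 l m lA) => h1 h2; split=> X c F G; rewrite !h; [exact: h1 | exact: h2].
apply: bilin_ext; [exact: bilin_twist | by apply: bilin_twisted_coboundary; exact: lin_twist_op |].
by move=> p f x y; rewrite twist_sp // h delta0_sp // twist_signK.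
Qed.

End Twist.

(** * Normalized cocycles and their structure constants *)

Section Normalization.
Variable K : numFieldType.
Implicit Types (F G H W : superpoly K) (A B : operator K) (U V : cochain K).
Implicit Types (g h : {poly K}) (p q f e : bool) (l m : K).

Definition twisted_cocycle l m V :=
  [/\ bilin V, (forall G, is_diffop (V G))
    & forall p q g h F, delta l m V p q g h F = 0].

(** Scalars seen as ring elements, so that [ring] can handle scalings. *)
Definition cst (c : K) : superpoly K := c *: sp_one K.

Lemma scale_cst c F : c *: F = cst c * F.
Proof. by rewrite /cst spZAl; congr (_ *: _); rewrite -[LHS]mul1r. Qed.

Lemma delta_lincomb l m U V c p q g h F :
  delta l m (fun G F => U G F - c *: V G F) p q g h F =
  delta l m U p q g h F - c *: delta l m V p q g h F.
Proof.
have hl l' G X Y : lie_density l' G (X - c *: Y) =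
    lie_density l' G X - c *: lie_density l' G Y.
  by rewrite addrC -scaleNr (@lin_lier K l' G) addrC scaleNr.
rewrite /delta !hl !scale_cst; ring.
Qed.

Lemma twisted_cocycle_lincomb l m U V c :
  twisted_cocycle l m U -> twisted_cocycle l m V ->
  twisted_cocycle l m (fun G F => U G F - c *: V G F).
Proof.
move=> [[u1 u2] du cu] [[v1 v2] dv cv]; split.
- by split=> X; apply: lin_add => //; apply/lin_opp/lin_scale.
- by move=> G; apply: diffop_sub => //; apply: diffop_scale.
- by move=> p q g h F; rewrite delta_lincomb cu cv scaler0 subr0.
Qed.

Lemma lie_rep l p q g h F :
  lie_density l (sp p g) (lie_density l (sp q h) F)
  - (-1) ^+ (p && q) *: lie_density l (sp q h) (lie_density l (sp p g) F)
  = lie_density l (contact_bracket (sp p g) (sp q h)) F.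
Proof.
have hl := @lin_lier K l.
move: F; apply: lin_ext; [|exact: hl|].
  by apply: lin_add; [|apply/lin_opp/lin_scale]; apply: lin_comp.
move=> f x; rewrite bracket_sp !lie_sp.
by case: p q f => [] [] []; rewrite /lie_poly /= ?(expr0, expr1, scaleN1r, scale1r);
  congr pair; polyid.
Qed.

(** The square of the differential is zero: by [lie_rep], brackets act as supercommutators on source
    and target, and then all terms cancel. *)
Lemma twisted_coboundary_cocycle l m A :
  is_diffop A -> twisted_cocycle l m (twisted_coboundary l m A).
Proof.
move=> dA; have lA := diffop_lin dA; split; first exact: bilin_twisted_coboundary.
  exact: diffop_twisted_coboundary.
move=> p q g h F; have ll := @lin_lier K.
have := lie_rep m p q g h (A F); have := lie_rep l p q g h F.
rewrite /delta /twisted_coboundary => <- <-.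
rewrite !(linD lA, linN lA, linZ lA) !(linD (ll _ _), linN (ll _ _)).
rewrite !scale_cst; ring.
Qed.

Lemma deriv_one : (1 : {poly K})^`() = 0.
Proof. by rewrite -polyC1 derivC. Qed.

Lemma lie_one l F : lie_density l (sp false 1) F = dx F.
Proof.
by case: F => a b; rewrite lie_densityE /dx /= ?deriv_one !mul1r; congr pair; polyid.
Qed.

Lemma lie_theta l F : lie_density l (sp true 1) F = 2^-1 *: zeta F.
Proof.
by case: F => a b; rewrite lie_densityE /zeta /= ?deriv_one !mul1r; congr pair; polyid.
Qed.

(** At i = 0 the convention that the inverse of 0 is 0 makes the constant term vanish. *)
Definition primitive g : {poly K} := \poly_(i < (size g).+1) (g`_i.-1 / i%:R).

Lemma primitiveK g : (primitive g)^`() = g.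
Proof.
apply/polyP => i; rewrite coef_deriv coef_poly ltnS; case: ltnP => [lt|ge] /=.
  by rewrite -[LHS]mulr_natr mulfVK // pnatr_eq0.
by rewrite mul0rn nth_default.
Qed.

Definition sprimitive W : superpoly K := (primitive W.1, primitive W.2).

Lemma sprimitiveK W : dx (sprimitive W) = W.
Proof. by case: W => a b; rewrite /dx /= !primitiveK. Qed.

Lemma dmon_dx i e F : dmon i e (dx F) = dx (dmon i e F).
Proof. by rewrite !dmonE /dx; case: e; congr pair; rewrite /= -?derivSn ?derivnS ?deriv0. Qed.

(** X_1 acts by d/dx, which commutes with the monomials [dmon i e]. Its commutator with an operator
    therefore differentiates the coefficients, and it suffices to integrate those of V(X_1). *)
Lemma normalize_one l m V : twisted_cocycle l m V ->
  exists2 A, is_diffop A &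
    forall F, V (sp false 1) F = twisted_coboundary l m A (sp false 1) F.
Proof.
case=> _ /(_ (sp false 1))[n [a h]] _.
exists (fun F => \sum_(i < n) \sum_e sprimitive (a i e) * dmon i e F).
  apply: diffop_sum => i; apply: diffop_sum => e; apply: diffop_mul.
  exact: diffop_dmon.
move=> F; rewrite /twisted_coboundary !lie_one h (lin_sumr (@lin_dx K)) -sumrB.
apply: eq_bigr => i _; rewrite !sum_bool (linD (@lin_dx K)) !dxM !sprimitiveK.
rewrite !dmon_dx -!/(dmon i _ F); ring.
Qed.

Lemma zetaM F G : zeta (F * G) = zeta F * G + psign F * zeta G.
Proof.
by case: F G => [a b] [c d]; rewrite !spMl psignE; congr pair; polyid.
Qed.

Lemma zeta_theta : zeta (theta K) = 1.
Proof. by rewrite /zeta /=; congr pair; rewrite /= deriv0. Qed.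

Lemma dx_theta : dx (theta K) = 0.
Proof. by rewrite /dx /=; congr pair; rewrite /= ?deriv0 ?deriv_one. Qed.

Lemma psign_theta : psign (theta K) = - theta K.
Proof. by rewrite psignE; congr pair; rewrite /= oppr0. Qed.

Lemma bracket_one_theta :
  contact_bracket (sp false 1) (sp true 1) = 0 :> superpoly K.
Proof.
by rewrite bracket_sp /lie_poly /= deriv_one mulr0 mul0r scaler0 addr0.
Qed.

Lemma bracket_theta_theta :
  contact_bracket (sp true 1) (sp true 1) = 2^-1 *: sp false 1 :> superpoly K.
Proof. by rewrite bracket_sp /lie_poly /= mulr1; congr pair; rewrite /= scaler0. Qed.

(** Put B = V(X_theta). The cocycle condition at (X_1, X_theta) says that B commutes with d/dx, and
    the one at (X_theta, X_theta) that B anticommutes with [zeta]. As X_theta acts by half of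
    [zeta], the operator 2 theta B has coboundary B at X_theta. Its coboundary at X_1 is zero, so
    the previous normalization survives. *)
Lemma normalize_theta l m V : twisted_cocycle l m V ->
  (forall F, V (sp false 1) F = 0) ->
  exists2 A, is_diffop A & forall F,
    twisted_coboundary l m A (sp false 1) F = 0 /\
    V (sp true 1) F = twisted_coboundary l m A (sp true 1) F.
Proof.
move=> [bV dV cV] V1; have lV := bV.1.
pose B := V (sp true 1); have lB : lin B := lV _.
exists (fun F => 2 *: (theta K * B F)).
  by apply: diffop_scale; apply: diffop_mul; exact: dV.
move=> F.
have c1 : dx (B F) - B (dx F) = 0.
  have := cV false true 1 1 F.
  rewrite /delta bracket_one_theta !lie_one !V1 (lin0 (@lin_lier K _ _)).
  by rewrite (bilin0l _ bV) scaler0 !subr0 expr0 scale1r addr0.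
have c2 : zeta (B F) + B (zeta F) = 0.
  have := cV true true 1 1 F.
  rewrite /delta bracket_theta_theta !lie_theta (linZ (bV.2 _)) V1.
  rewrite !(linZ (lV _)) scaler0 subr0 expr1 !scaleN1r !opprK => <-.
  by rewrite -addrA -!scalerDl half2 !scale1r.
split; rewrite /twisted_coboundary.
  rewrite !lie_one (linZ (@lin_dx K)) dxM dx_theta mul0r add0r.
  by move/eqP: c1; rewrite subr_eq0 => /eqP->; rewrite subrr.
rewrite !lie_theta (linZ (@lin_zeta K)) zetaM zeta_theta mul1r psign_theta.
rewrite (linZ lB) scalerA mulVf ?pnatr_eq0 // scale1r.
rewrite spZAr scalerA mulfV ?pnatr_eq0 // scale1r.
move/eqP: c2; rewrite addr_eq0 => /eqP->.
by rewrite mulrNN addrK.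
Qed.

Definition normal l m V := [/\ twisted_cocycle l m V,
  (forall F, V (sp false 1) F = 0) & (forall F, V (sp true 1) F = 0)].

Lemma normal_lincomb l m U V c :
  normal l m U -> normal l m V -> normal l m (fun G F => U G F - c *: V G F).
Proof.
move=> [tu u0 u1] [tv v0 v1]; split; first exact: twisted_cocycle_lincomb.
  by move=> F; rewrite u0 v0 scaler0 subr0.
by move=> F; rewrite u1 v1 scaler0 subr0.
Qed.

Lemma normalize l m V : twisted_cocycle l m V ->
  exists2 A, is_diffop A & normal l m (fun G F => V G F - twisted_coboundary l m A G F).
Proof.
move=> tV; have [A dA hA] := normalize_one tV.
have tA := twisted_coboundary_cocycle l m dA.
have tV1 := twisted_cocycle_lincomb 1 tV tA.
have [|B dB hB] := normalize_theta tV1.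
  by move=> F; rewrite hA scale1r subrr.
have tB := twisted_coboundary_cocycle l m dB.
exists (fun F => A F + B F); first exact: diffop_add.
have e G F : V G F - twisted_coboundary l m (fun F => A F + B F) G F =
    V G F - 1 *: twisted_coboundary l m A G F - 1 *: twisted_coboundary l m B G F.
  rewrite /twisted_coboundary (linD (@lin_lier K m G)) !scale1r; ring.
split.
- case: (twisted_cocycle_lincomb 1 tV1 tB) => b d c; split.
  + by case: b => b1 b2; split=> X x F G; rewrite !e; [exact: b1 | exact: b2].
  + by move=> G; apply: diffop_ext (d G) => F; rewrite e.
  + by move=> p q g h F; rewrite -(c p q g h F) /delta !e.
- by move=> F; rewrite e hA (hB F).1 !scale1r subrr subr0.
- by move=> F; rewrite e -(hB F).2 !scale1r subrr.
Qed.

End Normalization.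

(** * Values at 0 on monomials *)

Section StructureConstants.
Variable K : numFieldType.
Implicit Types (F G H W : superpoly K) (A B : operator K) (U V : cochain K).
Implicit Types (g h : {poly K}) (p q f e : bool) (l m : K) (i j k n : nat).

Definition ev W : K := W.1.[0].
Definition mon e i : superpoly K := sp e 'X^i.
Definition gam V p f i k : K := ev (V (mon p i) (mon f k)).
Definition half_parity e : K := if e then 2^-1 else 0.

Lemma evD F G : ev (F + G) = ev F + ev G. Proof. by rewrite /ev hornerD. Qed.
Lemma evN F : ev (- F) = - ev F. Proof. by rewrite /ev hornerN. Qed.
Lemma evZ c F : ev (c *: F) = c * ev F. Proof. by rewrite /ev hornerZ. Qed.
Lemma ev0 : ev 0 = 0. Proof. by rewrite /ev horner0. Qed.
Lemma ev_sum (I : Type) (r : seq I) (P : pred I) (F : I -> superpoly K) :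
  ev (\sum_(i <- r | P i) F i) = \sum_(i <- r | P i) ev (F i).
Proof. by apply: (big_morph ev); [exact: evD | exact: ev0]. Qed.

(** The index i stands for the exponent i + 1 of the field, so that the exponent i + k + (e && f) of
    the result involves no truncated subtraction. Exponent 0 is covered by normality. *)
Definition lie_coef l e f i k : K :=
  if e then if f then 2^-1 else k%:R / 2 + l * i.+1%:R
  else k%:R + (l + half_parity f) * i.+1%:R.

Lemma Xn_deriv i k : 'X^(i.+1) * ('X^k)^`() = k%:R *: 'X^(i + k) :> {poly K}.
Proof.
rewrite derivXn -mulr_natr mulrA -exprD -mul_polyC polyC_natr mulrC.
by case: k => [|k]; rewrite ?mul0r //= addSnnS.
Qed.

Lemma deriv_Xn i k : ('X^(i.+1))^`() * 'X^k = i.+1%:R *: 'X^(i + k) :> {poly K}.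
Proof. by rewrite derivXn /= mulrnAl -exprD scaler_nat. Qed.

Lemma lie_poly_mon l e f i k :
  lie_poly l e f 'X^(i.+1) 'X^k = lie_coef l e f i k *: 'X^(i + k + (e && f)).
Proof.
rewrite /lie_poly Xn_deriv deriv_Xn /lie_coef.
case: e f => [] [] /=; rewrite ?addn0 ?addn1 ?scalerA -?scalerDl //.
- by rewrite -exprD addSn.
- by rewrite [2^-1 * _]mulrC.
Qed.

Lemma lie_mon l e f i k :
  lie_density l (mon e i.+1) (mon f k) =
  lie_coef l e f i k *: mon (e (+) f) (i + k + (e && f)).
Proof. by rewrite lie_sp lie_poly_mon spZ. Qed.

Lemma bracket_mon e f i k : contact_bracket (mon e i.+1) (mon f k) =
  lie_coef (- 1) e f i k *: mon (e (+) f) (i + k + (e && f)).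
Proof. by rewrite bracketE lie_mon. Qed.

(** Among the monomial fields with positive exponent, only X_x acts on values at 0, and it
    multiplies them by the weight. This makes the cocycle conditions scalar. *)
Lemma ev_lie_mon l p i W :
  ev (lie_density l (mon p i.+1) W) = (~~ (p || (0 < i)%N))%:R * (l * ev W).
Proof.
rewrite /ev lie_densityE; case: p; rewrite /= !(hornerD, hornerZ, hornerM, hornerXn,
  horner0, deriv0, derivXn, hornerMn) ?expr0n /= ?(mul0r, mulr0, addr0, add0r) //.
by case: i => [|i] /=; rewrite ?mul1r ?(mul0rn, mul0r, mulr0).
Qed.

(** The cocycle condition evaluated at 0. The hypothesis keeps X_x out of the first slot, so the
    target action contributes only through the second one, on the right-hand side. *)
Lemma structure_eq l m V p q f i j k : twisted_cocycle l m V -> p || (0 < i)%N ->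
  lie_coef l q f j k * gam V p (q (+) f) i.+1 (j + k + (q && f))
  - (-1) ^+ (p && q) * (lie_coef l p f i k * gam V q (p (+) f) j.+1 (i + k + (p && f)))
  - lie_coef (- 1) p q i j.+1 * gam V (p (+) q) f (i + j.+1 + (p && q)) k
  = (~~ (q || (0 < j)%N))%:R * (m * gam V p f i.+1 k).
Proof.
move=> [[b1 b2] _ c] pi; have := c p q 'X^(i.+1) 'X^(j.+1) (mon f k).
move/(congr1 ev); rewrite /delta -!/(mon _ _) bracket_mon !lie_mon.
move: (ev_lie_mon m p i (V (mon q j.+1) (mon f k))).
move: (ev_lie_mon m q j (V (mon p i.+1) (mon f k))).
move: (lie_density m _ _) (lie_density m _ _) => a b ea eb.
rewrite !(linZ (b1 _)) (linZ (b2 _)) !(evD, evN, evZ) ea eb pi /= mul0r ev0.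
rewrite add0r -!/(gam _ _ _ _ _) => h.
case: q {ea eb} h => /= h; rewrite ?andbF ?andbT ?expr0 ?mul1r ?mul0r in h *.
  by apply/eqP; rewrite -[X in _ == X]h; apply/eqP; ring.
by apply/eqP; rewrite -subr_eq0 -[X in _ == X]h; apply/eqP; ring.
Qed.

(** The cocycle condition with X_theta: V vanishes there, and X_theta acts by half of [zeta] on
    densities of every weight, including the adjoint module. *)
Lemma zeta_cochain l m V q h F : normal l m V ->
  zeta (V (sp q h) F) = V (zeta (sp q h)) F + (-1) ^+ q *: V (sp q h) (zeta F).
Proof.
move=> [[[b1 b2] _ c] _ v1]; have := c true q 1 h F.
rewrite /delta bracketE !lie_theta !v1 (lin0 (@lin_lier K _ _)) scaler0 subr0 addr0.
rewrite (linZ (b1 _)) (linZ (b2 _)) /= => e.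
apply: subr0_eq.
set X : superpoly K := _ - _; have /eqP : 2^-1 *: X = 0 :> superpoly K.
  by rewrite -[RHS]e /X !scale_cst; ring.
by rewrite scaler_eq0 invr_eq0 pnatr_eq0 => /eqP.
Qed.

Lemma lin_poly A f h : lin A ->
  A (sp f h) = \sum_(i < size h) h`_i *: A (mon f i).
Proof.
move=> lA; rewrite -[in LHS](coefK h) poly_def.
have -> : sp f (\sum_(i < size h) h`_i *: 'X^i) = \sum_(i < size h) h`_i *: mon f i.
  elim/big_rec2: _ => [|i x y _ <-]; first exact: sp0.
  by rewrite spD spZ.
rewrite (lin_sumr lA).
by apply: eq_bigr => i _; rewrite (linZ lA).
Qed.

Lemma iter_zeta i W : iter i.*2 (@zeta K) W = dxn i W.
Proof. by elim: i => //= i ->. Qed.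

Lemma horner0_derivn g i : g^`(i).[0] = g`_i *+ i`!.
Proof. by rewrite horner_coef0 coef_derivn addn0 ffactnn. Qed.

(** Even iterates of [zeta] read off the Taylor coefficients at 0 of the first component, odd
    iterates those of the second, up to nonzero factorials. *)
Lemma ev_zeta_eq0 W : (forall i, ev (iter i (@zeta K) W) = 0) -> W = 0.
Proof.
move=> h.
have z g : (forall i, g^`(i).[0] = 0) -> g = 0.
  move=> hg; apply/polyP => i; apply/eqP; rewrite coef0.
  by have /eqP := hg i; rewrite horner0_derivn mulrn_eq0 -leqn0 leqNgt fact_gt0.
case: W h => a b h; congr pair; apply: z => i.
  by have := h i.*2; rewrite iter_zeta dxnE.
by have := h i.*2.+1; rewrite iterSr iter_zeta dxnE.
Qed.

(** [zeta_cochain] moves the iterates of [zeta] onto the arguments, so all Taylor coefficients of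
    the values of V reduce to values at 0, and by bilinearity to the scalars [gam]. *)
Lemma normal_eq0 l m V : normal l m V -> (forall p f i k, gam V p f i k = 0) ->
  forall G F, V G F = 0.
Proof.
move=> nV g0; have [[[b1 b2] _ _] _ _] := nV.
have E0 G F : ev (V G F) = 0.
  rewrite (spE G) (spE F) !(linD (b2 _)) !(linD (b1 _)) !evD.
  have z p f g h : ev (V (sp p g) (sp f h)) = 0.
    rewrite (lin_poly p g (b2 _)) ev_sum big1 // => i _; rewrite evZ.
    rewrite (lin_poly f h (b1 _)) ev_sum big1 ?mulr0 // => k _; rewrite evZ.
    by rewrite -/(gam V p f i k) g0 mulr0.
  by rewrite !z !addr0.
have Ek i : forall G F, ev (iter i (@zeta K) (V G F)) = 0.
  elim: i => [|i IHi] G F; first exact: E0.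
  have lz : lin (iter i (@zeta K)).
    by elim: (i) => // j hj; apply: (lin_comp (@lin_zeta K)).
  rewrite iterSr (spE G) (linD (b2 _)) (linD (@lin_zeta K)).
  by rewrite !(zeta_cochain _ _ _ nV) !(linD lz) !(linZ lz) !evD !evZ !IHi !mulr0 !addr0.
by move=> G F; apply: ev_zeta_eq0 => i; exact: Ek.
Qed.

Lemma ev_dxn_zeta n e f k :
  ev (dxn n (iter e (@zeta K) (mon f k))) = ((n == k) && (e == f))%:R * k`!%:R.
Proof.
rewrite /ev dxnE; case: e; case: f; rewrite /= ?linear0 ?horner0 ?andbF ?mul0r //.
  rewrite horner0_derivn coefXn.
  by case: eqP => [->|_]; rewrite ?mul1r ?mul0r ?mul0rn.
rewrite horner0_derivn coefXn.
by case: eqP => [->|_]; rewrite ?mul1r ?mul0r ?mul0rn.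
Qed.

Lemma ev_mul F G : ev (F * G) = ev F * ev G.
Proof. by rewrite /ev /= hornerM. Qed.

Lemma diffop_ev_eq0 A : is_diffop A ->
  exists N, forall f k, (N <= k)%N -> ev (A (mon f k)) = 0.
Proof.
case=> n [a h]; exists n => f k le; rewrite h ev_sum big1 // => i _.
rewrite ev_sum big1 // => e _; rewrite ev_mul -/(dmon i e _) dmonE /ev.
have ik : (i == k :> nat) = false by rewrite ltn_eqF // (leq_trans _ le).
by case: e; case: f; rewrite /= ?linear0 ?horner0 ?mulr0 // horner0_derivn coefXn
  ik mul0rn mulr0.
Qed.

Definition reduced l m V := normal l m V /\
  forall f k, k%:R + half_parity f <> m - l -> gam V false f 1 k = 0.

(** X_x is diagonal on monomials. The cocycle condition with X_x thus equates the weight defect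
    times this scalar to a multiple of a value at X_x with the same defect, and that value vanishes
    since V is reduced. *)
Lemma reduced_weight l m V p f i k : reduced l m V ->
  i%:R + half_parity p + k%:R + half_parity f <> m - l + 1 -> gam V p f i k = 0.
Proof.
move=> [nV h1] w; have [tV v0 v1] := nV.
case: i w => [|i] w; first by rewrite /gam /mon expr0; case: p w; rewrite ?v0 ?v1 ev0.
case pi : (p || (0 < i)%N); last first.
  move/negbT: pi; rewrite negb_or -leqNgt leqn0 => /andP[/negPf p0 /eqP i0].
  rewrite p0 i0 in w *; apply: h1 => e; apply: w; rewrite -e /half_parity; ring.
have := structure_eq false f 0 k tV pi; rewrite /= !andbF expr0 mul1r add0n !addn0.
rewrite (h1 (p (+) f)) ?mulr0 ?subr0; last first.
  move=> e; apply: w; rewrite -[m - l]e !natrD -[i.+1]addn1 natrD /half_parity.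
  by case: (p); case: (f); rewrite /=; field.
rewrite mul1r addn1 addbF => e.
have /eqP : (k%:R + (l + half_parity f) * 1 - lie_coef (- 1) p false i 1 - m) * gam V p f i.+1
  k = 0.
  by rewrite !mulrBl -e; ring.
rewrite mulf_eq0 => /orP[/eqP {}e|/eqP //].
case: w; apply: subr0_eq; rewrite -[RHS]e /lie_coef -[i.+1]addn1 natrD.
by case: (p); rewrite /half_parity /=; field.
Qed.

End StructureConstants.
Arguments mon {K}.
Arguments half_parity {K}.

(** * Reduction to one weight and to three generators *)

Section Classification.
Variable K : numFieldType.
Implicit Types (F G H W : superpoly K) (A B : operator K) (U V : cochain K).
Implicit Types (g h : {poly K}) (p q f e : bool) (l m : K) (i j k n d : nat).

Lemma gam_lincomb U V c p f i k :
  gam (fun G F => U G F - c *: V G F) p f i k = gam U p f i k - c * gam V p f i k.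
Proof. by rewrite /gam evD evN evZ. Qed.

Lemma reduced_lincomb l m U V c : reduced l m U -> reduced l m V ->
  reduced l m (fun G F => U G F - c *: V G F).
Proof.
move=> [nU hU] [nV hV]; split; first exact: normal_lincomb.
by move=> f k w; rewrite gam_lincomb hU // hV // mulr0 subr0.
Qed.

Lemma gam_coboundary l m A p f i k : lin A -> p || (0 < i)%N ->
  gam (twisted_coboundary l m A) p f i.+1 k =
  - (lie_coef l p f i k * ev (A (mon (p (+) f) (i + k + (p && f))))).
Proof.
move=> lA pi; have := ev_lie_mon m p i (A (mon f k)).
rewrite /gam /twisted_coboundary lie_mon; move: (lie_density _ _ _) => X.
by rewrite (linZ lA) evD evN evZ pi mul0r => ->; rewrite add0r.
Qed.

Lemma gam_coboundary_x l m A f k : lin A ->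
  gam (twisted_coboundary l m A) false f 1 k = (m - l - k%:R - half_parity f) * ev (A (mon f k)).
Proof.
move=> lA; have := ev_lie_mon m false 0 (A (mon f k)).
rewrite /gam /twisted_coboundary lie_mon; move: (lie_density _ _ _) => X.
rewrite (linZ lA) evD evN evZ => -> /=; rewrite addn0 add0n /lie_coef; ring.
Qed.

(** The power 2 n + e of [zeta]. It commutes with X_1 and X_theta, so subtracting its coboundary
    preserves normality. *)
Definition zeta_op n e : operator K := fun F => dxn n (iter e (@zeta K) F).

Lemma zeta_op_zeta n e F : zeta_op n e (zeta F) = zeta (zeta_op n e F).
Proof.
have c W : dxn n (zeta W) = zeta (dxn n W).
  by rewrite -!iter_zeta -iterSr -iterS.
by rewrite /zeta_op; case: e; rewrite /= c.
Qed.

Lemma zeta_op_dx n e F : zeta_op n e (dx F) = dx (zeta_op n e F).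
Proof.
have dE W : dx W = zeta (zeta W) by case: W.
by rewrite !dE !zeta_op_zeta.
Qed.

Lemma diffop_zeta_op n e : is_diffop (zeta_op n e).
Proof.
apply: (diffop_comp (diffop_dxn K n)); case: e; [exact: diffop_zeta | exact: diffop_id].
Qed.

Lemma normal_coboundary l m A : is_diffop A ->
  (forall F, A (dx F) = dx (A F)) -> (forall F, A (zeta F) = zeta (A F)) ->
  normal l m (twisted_coboundary l m A).
Proof.
move=> dA cx cz; have lA := diffop_lin dA.
split; first exact: twisted_coboundary_cocycle.
  by move=> F; rewrite /twisted_coboundary !lie_one cx subrr.
by move=> F; rewrite /twisted_coboundary !lie_theta (linZ lA) cz subrr.
Qed.

Lemma normal_ext l m U V : (forall G F, U G F = V G F) -> normal l m V -> normal l m U.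
Proof.
move=> e [[[b1 b2] d c] v0 v1]; split; [split; [split=> X a F G|move=> G|] | |].
- by rewrite !e; exact: b1.
- by rewrite !e; exact: b2.
- by apply: diffop_ext (d G) => F; rewrite e.
- by move=> p q g h F; rewrite -(c p q g h F) /delta !e.
- by move=> F; rewrite e.
- by move=> F; rewrite e.
Qed.

Lemma reduced_ext l m U V : (forall G F, U G F = V G F) -> reduced l m V -> reduced l m U.
Proof.
move=> e [nV h]; split; first exact: normal_ext nV.
by move=> f k w; rewrite /gam e; exact: h.
Qed.

Lemma reduce l m V : twisted_cocycle l m V ->
  exists2 A, is_diffop A & reduced l m (fun G F => V G F - twisted_coboundary l m A G F).
Proof.
move=> tV; have [A dA] := normalize tV; set V' := (fun _ => _) => nV.
(* The operator V'(X_x) has finite order, so only finitely many powers of [zeta] are required. *)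
have [N hN] := diffop_ev_eq0 (let: And3 t _ _ := nV in let: And3 _ d _ := t in d (mon false 1)).
(* At X_x and theta^f x^k, the coboundary of [zeta_op k f] has value (m - l - k - [half_parity f])
   k!. At the critical weight the denominator is 0, hence so is the coefficient, and nothing is
   subtracted. *)
pose t f k := gam V' false f 1 k / (m - l - k%:R - half_parity f).
pose B F := \sum_(k < N) \sum_(f : bool) (t f k / k`!%:R) *: zeta_op k f F.
have dB : is_diffop B.
  apply: diffop_sum => k; apply: diffop_sum => f; apply: diffop_scale.
  exact: diffop_zeta_op.
have lB := diffop_lin dB.
have nB : normal l m (twisted_coboundary l m B).
  apply: normal_coboundary => // F.
    rewrite (lin_sumr (@lin_dx K)); apply: eq_bigr => k _.
    by rewrite !sum_bool (linD (@lin_dx K)) !(linZ (@lin_dx K)) !zeta_op_dx.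
  rewrite (lin_sumr (@lin_zeta K)); apply: eq_bigr => k _.
  by rewrite !sum_bool (linD (@lin_zeta K)) !(linZ (@lin_zeta K)) !zeta_op_zeta.
exists (fun F => A F + B F); first exact: diffop_add.
have nVB := normal_lincomb 1 nV nB.
apply: (@reduced_ext _ _ _ (fun G F => V' G F - 1 *: twisted_coboundary l m B G F)).
  move=> G F; rewrite /V' scale1r /twisted_coboundary (linD (@lin_lier K m G)); ring.
split=> // f k w; rewrite gam_lincomb mul1r gam_coboundary_x //.
case: (ltnP k N) => [lt|ge]; last first.
  have -> : gam V' false f 1 k = 0 by exact: hN.
  rewrite ev_sum big1 ?mulr0 ?subrr // => i _; rewrite ev_sum big1 // => e _.
  by rewrite evZ ev_dxn_zeta ltn_eqF ?mul0r ?mulr0 // (leq_trans _ ge).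
have -> : ev (B (mon f k)) = ev (\sum_(e : bool) (t e k / k`!%:R) *: zeta_op k e (mon f k)).
  rewrite ev_sum (bigD1 (Ordinal lt)) //= -[RHS]addr0; congr (_ + _).
  apply: big1 => i /negPf ni.
  rewrite ev_sum big1 // => e _; rewrite evZ ev_dxn_zeta.
  have -> : (i == k :> nat) = false by move: ni; rewrite -val_eqE.
  by rewrite mul0r mulr0.
rewrite sum_bool evD !evZ !ev_dxn_zeta eqxx /=.
have k0 : k`!%:R != 0 :> K by rewrite pnatr_eq0 -lt0n fact_gt0.
have w0 : m - l - k%:R - half_parity f != 0.
  by apply/eqP => e; apply: w; apply/esym/subr0_eq; rewrite -[RHS]e; ring.
rewrite /t; case: (f) w0 => w0; rewrite /= mul0r mulr0 ?addr0 ?add0r mul1r divfK //;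
  by rewrite mulrC divfK // subrr.
Qed.

(** Induction by brackets with theta x: [up0] uses {theta x, theta x^(j+1)} = x^(j+2) / 2, and [up1]
    uses {theta x, x^(j+3)} = (j+1)/2 theta x^(j+3). The latter starts at exponent 3, so theta x^2
    needs its own hypothesis. *)
Lemma reduced_eq0 l m V : normal l m V ->
  (forall f k, [/\ gam V false f 1 k = 0, gam V true f 1 k = 0 & gam V true f 2 k = 0]) ->
  forall G F, V G F = 0.
Proof.
move=> nV h; have [tV v0 v1] := nV; apply: (normal_eq0 nV).
have h01 f k := let: And3 x _ _ := h f k in x.
have h11 f k := let: And3 _ x _ := h f k in x.
have h12 f k := let: And3 _ _ x := h f k in x.
have two : (2^-1 : K) != 0 by rewrite invr_eq0 pnatr_eq0.
have up0 j : (forall f k, gam V true f j.+1 k = 0) ->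
    forall f k, gam V false f j.+2 k = 0.
  move=> hj f k; have := structure_eq true f j k tV (isT : true || (0 < 0)%N).
  rewrite h11 hj !mulr0 subr0 mul0r sub0r /lie_coef /= add0n addn1 => /eqP.
  by rewrite oppr_eq0 mulf_eq0 (negPf two) => /eqP.
have up1 j : (forall f k, gam V false f j.+3 k = 0) ->
    forall f k, gam V true f j.+3 k = 0.
  move=> hj f k; have := structure_eq false f j.+2 k tV (isT : true || (0 < 0)%N).
  rewrite h11 hj !mulr0 subr0 mul0r sub0r /= add0n addn0 => /eqP.
  rewrite oppr_eq0 mulf_eq0 => /orP[|/eqP //]; rewrite /lie_coef mulr1.
  have -> : j.+3%:R / 2 + - 1 = j.+1%:R / 2 :> K.
    by rewrite -[j.+3]addn3 -[j.+1]addn1 !natrD; field.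
  by rewrite mulf_eq0 pnatr_eq0 (negPf two).
have all1 i : forall f k, gam V true f i k = 0.
  case: i => [|[|[|i]]] //; first by move=> f k; rewrite /gam /mon expr0 v1 ev0.
  by elim: i => [|i IHi]; apply: up1; apply: up0.
case=> // f [|[|i]] k; first by rewrite /gam /mon expr0 v0 ev0.
  exact: h01.
exact: up0.
Qed.

Lemma weight_nat l m V d p f i k : m = l + d%:R / 2 -> reduced l m V ->
  ((i + k).*2 + p + f != d.+2)%N -> gam V p f i k = 0.
Proof.
move=> em rV w; apply: (reduced_weight rV) => e; move/eqP: w; apply.
apply/eqP; rewrite -(eqr_nat K) -[d.+2]addn2 -addnn !natrD.
have -> : d%:R = 2 * (m - l) :> K by rewrite em; field.
have -> : m - l = i%:R + half_parity p + k%:R + half_parity f - 1 by rewrite e addrK.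
by apply/eqP; rewrite /half_parity; case: (p); case: (f); rewrite /=; field.
Qed.

(* The coefficient of gam V p f i.+1 k in the cocycle condition with X_x is zero
   at the only weight where this scalar can be nonzero. *)
Lemma x_row l m V p f i k : reduced l m V -> p || (0 < i)%N ->
  lie_coef l p f i k * gam V false (p (+) f) 1 (i + k + (p && f)) = 0.
Proof.
move=> rV pi; have tV : twisted_cocycle l m V by case: rV => -[].
have := structure_eq false f 0 k tV pi.
rewrite /= !andbF expr0 !mul1r add0n !addn0 addn1 addbF => e.
have {e} -> : lie_coef l p f i k * gam V false (p (+) f) 1 (i + k + (p && f)) =
    (k%:R + (l + half_parity f) * 1 - lie_coef (- 1) p false i 1 - m) * gam V p f i.+1 k.
  by rewrite !mulrBl -e; ring.
have [w|w] := eqVneq (i.+1%:R + half_parity p + k%:R + half_parity f) (m - l + 1); last first.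
  by rewrite (reduced_weight rV) ?mulr0 //; apply/eqP.
suff -> : k%:R + (l + half_parity f) * 1 - lie_coef (- 1) p false i 1 - m = 0 by rewrite mul0r.
have -> : m = i.+1%:R + half_parity p + k%:R + half_parity f - 1 + l by rewrite w; ring.
by rewrite /lie_coef -[i.+1]addn1 natrD; case: (p); rewrite /half_parity /=; field.
Qed.

(** By [x_row], the values at X_x are killed by every nonzero coefficient of the action. For d even,
    theta x acts with coefficient 1/2. For d odd, the coefficients of theta x and theta x^2 cannot
    both vanish; when d = 1 only theta x is available, with coefficient l. *)
Lemma gam_x_eq0 l m V d : m = l + d%:R / 2 -> reduced l m V ->
  (0 < d)%N -> (d = 1%N -> l <> 0) -> forall f k, gam V false f 1 k = 0.
Proof.
move=> em rV d0 d1 f k.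
have [w|w] := eqVneq ((1 + k).*2 + false + f)%N d.+2; last exact: (weight_nat em rV w).
case: f w => w; last first.
  case: k w => [|k] w; first by move: w d0 => /=; lia.
  have := @x_row l m V true true 0 k rV isT; rewrite /= add0n addn1 => /eqP.
  by rewrite mulf_eq0 invr_eq0 pnatr_eq0 => /eqP.
have /eqP := @x_row l m V true false 0 k rV isT; rewrite /= add0n addn0 mulf_eq0.
case/orP=> /eqP // e0; case: k w e0 => [|k] w e0.
  by case: d1; [lia | rewrite -[LHS]mulr1 -[RHS]e0 /lie_coef /= mul0r add0r].
have /eqP := @x_row l m V true false 1 k rV isT; rewrite /= add1n addn0 mulf_eq0.
case/orP=> /eqP // e1.
(* This combination of the two coefficients eliminates l. *)
have : k.+2%:R = 0 :> K.
  have -> : k.+2%:R = (2 * lie_coef l true false 0 k.+1 - lie_coef l true false 1 k) * 2.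
    by rewrite /lie_coef -[k.+2]addn2 -[k.+1]addn1 !natrD; field.
  by rewrite /lie_coef /= e0 e1 mulr0 subrr mul0r.
by move/eqP; rewrite pnatr_eq0.
Qed.

End Classification.

(** * The recurrences *)

Section Obstructions.
Variable K : numFieldType.
Implicit Types (F G H W : superpoly K) (A B : operator K) (U V T : cochain K).
Implicit Types (p q f e : bool) (l m c : K) (i j k n d : nat).

Lemma odd_odd_eq l m V f i j k : twisted_cocycle l m V ->
  lie_coef l true f j k * gam V true (~~ f) i.+1 (j + k + f)
  + lie_coef l true f i k * gam V true (~~ f) j.+1 (i + k + f)
  = 2^-1 * gam V false f (i + j).+2 k.
Proof.
move=> tV; have := structure_eq true f j k tV (isT : true || (0 < i)%N).
rewrite /= mul0r expr1 mulN1r opprK addn1 addnS => /subr0_eq ->.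
by [].
Qed.

Lemma odd_even_eq l m V f i j k : twisted_cocycle l m V ->
  lie_coef l false f j.+1 k * gam V true f i.+1 (j + k).+1
  - lie_coef l true f i k * gam V false (~~ f) j.+2 (i + k + f)
  = (j.+2%:R / 2 - i.+1%:R) * gam V true f (i + j).+2 k.
Proof.
move=> tV; have := structure_eq false f j.+1 k tV (isT : true || (0 < i)%N).
rewrite /= mul0r expr0 mul1r !addn0 addSn addnS addnS mulN1r => /subr0_eq ->.
by [].
Qed.

Lemma mulf_eq0_cancel (a x : K) : a != 0 -> a * x = 0 -> x = 0.
Proof. by move=> a0 /eqP; rewrite mulf_eq0 (negPf a0) => /eqP. Qed.

(** * Obstructions for even d *)

Section Even.
Variables (l m : K) (V : cochain K).
Hypothesis tV : twisted_cocycle l m V.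
Hypothesis V11 : forall f k, gam V true f 1 k = 0.

Let P i k := gam V true true i k.
Let Q i k := gam V false false i k.

(** The condition at (theta x, theta x^i), whose bracket is x^(i+1) / 2. *)
Lemma even_down i k : (0 < i)%N -> Q i.+1 k = (k%:R + 2 * l) * P i k.
Proof.
case: i => // i _.
have := odd_odd_eq false 0 i k tV; rewrite V11 mulr0 add0r /lie_coef /= !add0n addn0 => e.
transitivity (2 * (2^-1 * Q i.+2 k)); first by field.
by rewrite -e /P; field.
Qed.

(** The condition at (theta x, x^(i+1)), with both values at even fields expressed through P by
    [even_down]. *)
Lemma even_up i k : (0 < i)%N -> (k%:R + 1 + 2 * l) * P i k.+1 = (1 - i%:R) * P i.+1 k.
Proof.
case: i => // i _.
have -> : k%:R + 1 = k.+1%:R :> K by rewrite natr1.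
rewrite -even_down //.
have := odd_even_eq true 0 i k tV; rewrite V11 mulr0 sub0r /lie_coef /= !add0n addn1 => e.
transitivity (- (2 * - (2^-1 * Q i.+2 k.+1))); first by field.
by rewrite e -[i.+2]addn2 -[i.+1]addn1 !natrD /P; field.
Qed.

(** The bracket of theta x^2 with itself is x^4 / 2, which [even_down] and [even_up] also reach from
    theta x^2 by way of theta x^3. The scalar P 2 (n+1) has d = 2 n + 6. The factor is 2 l (2 l + 5)
    for n = 0 and 2 (2 l^2 + 7 l + 2) for n = 1, whose roots are the exceptional weights. *)
Lemma even_obstruction3 n :
  (2 * (n%:R + 4 * l) + (n%:R + 2 * l) * (n%:R + 1 + 2 * l)) * P 2 n.+1 = 0.
Proof.
have e1 := even_up n (isT : 0 < 2)%N.
have := odd_odd_eq false 1 1 n tV; rewrite /lie_coef /= add1n addn0 -/(P 2 n.+1) -/(Q 4 n).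
rewrite even_down // => /eqP; rewrite -subr_eq0 => /eqP e.
have p3 : P 3 n = - ((n%:R + 1 + 2 * l) * P 2 n.+1) by rewrite e1; ring.
by rewrite p3 in e; have := congr1 ( *%R 2) e; rewrite mulr0 => <-; field.
Qed.

(** Here d = 2 n + 10. Then theta x^3 bracketed with itself gives a second polynomial condition on n
    and l, which has no common solution with [even_obstruction3] for n natural. *)
Lemma even_obstruction5 n : P 2 n.+3 = 0.
Proof.
have e2 := even_up n.+2 (isT : 0 < 2)%N.
have e3 := even_up n.+1 (isT : 0 < 3)%N.
have e4 := even_up n (isT : 0 < 4)%N.
have o := even_obstruction3 n.+2.
have := odd_odd_eq false 2 2 n tV; rewrite /lie_coef /= add2n addn0 -/(P 3 n.+2) -/(Q 6 n).
rewrite even_down // => /eqP; rewrite -subr_eq0 => /eqP e.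
have [//|p2] := eqVneq (P 2 n.+3) 0.
have {}o : 2 * (n.+2%:R + 4 * l) + (n.+2%:R + 2 * l) * (n.+2%:R + 1 + 2 * l) = 0.
  by apply: (mulf_eq0_cancel p2); rewrite mulrC.
(* With this s, the obstruction [o] says that 2 (n + 5) = s (s - 1), and the
   equation [e] becomes (s - 2) s (s - 1) (s + 1) = 0. *)
pose s : K := n%:R + 5 + 2 * l.
have hl : 2 * l = s - n%:R - 5 by rewrite /s; ring.
have hn : 2 * n%:R = s ^+ 2 - s - 10.
  apply: subr0_eq; rewrite -[RHS]oppr0 -[in RHS]o /s -[n.+2]addn2 natrD; ring.
have p3 : P 3 n.+2 = - ((n%:R + 3 + 2 * l) * P 2 n.+3).
  apply: (mulfI (x := - 1)); rewrite ?oppr_eq0 ?oner_eq0 // mulrNN mul1r.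
  by transitivity ((n.+2%:R + 1 + 2 * l) * P 2 n.+3);
    [rewrite e2 | rewrite -[n.+2]addn2 natrD]; ring.
have p4 : 2 * P 4 n.+1 = - ((n%:R + 2 + 2 * l) * P 3 n.+2).
  transitivity (- ((n.+1%:R + 1 + 2 * l) * P 3 n.+2)); last by rewrite -[n.+1]addn1 natrD; ring.
  by rewrite e3; ring.
have p5 : 3 * P 5 n = - ((n%:R + 1 + 2 * l) * P 4 n.+1) by rewrite e4; ring.
have p5' : 6 * P 5 n = (n%:R + 1 + 2 * l) * (n%:R + 2 + 2 * l) * P 3 n.+2.
  transitivity (2 * (3 * P 5 n)); first by ring.
  transitivity (- (n%:R + 1 + 2 * l) * (2 * P 4 n.+1)); first by rewrite p5; ring.
  by rewrite p4; ring.
have q0 : (s - 2) * s * (s - 1) * (s + 1) * P 2 n.+3 = 0.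
  transitivity ((6 * (2 * n%:R) + 36 * (2 * l)
      - (n%:R + 2 * l) * (n%:R + 1 + 2 * l) * (n%:R + 2 + 2 * l)) * P 3 n.+2).
    rewrite p3 hl.
    transitivity ((36 * s - 180 - 12 * (2 * n%:R) - (s - 5) * (s - 4) * (s - 3))
      * - ((s - 2) * P 2 n.+3)); last by ring.
    by rewrite hn; ring.
  have := congr1 ( *%R 12) e; rewrite mulr0 => <-.
  transitivity ((6 * (2 * n%:R) + 36 * (2 * l)) * P 3 n.+2 - (n%:R + 2 * l) * (6 * P 5 n)).
    by rewrite p5'; ring.
  by field.
move/eqP: q0; rewrite mulf_eq0 (negPf p2) orbF !mulf_eq0.
(* For s = 2, 0, 1, -1 the relation [hn] gives 2 n = -8, -10, -10, -8. *)
have bad i : 2 * n%:R = - i.+1%:R :> K -> False.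
  move/eqP; rewrite -addr_eq0 -natrM -natrD pnatr_eq0; lia.
case/orP => [/orP[/orP[]|]|] /eqP e0.
- case: (bad 7%N); rewrite hn (subr0_eq e0); ring.
- case: (bad 9%N); rewrite hn e0; ring.
- case: (bad 9%N); rewrite hn (subr0_eq e0); ring.
- case: (bad 7%N); rewrite hn -[s](addrK 1) e0; ring.
Qed.

End Even.

(** * Obstructions for odd d *)

Section Odd.
Variables (l m : K) (V : cochain K).
Hypothesis tV : twisted_cocycle l m V.

Let R i k := gam V true false i k.
Let S i k := gam V false true i k.

(** Up to scalars, x^4 is both {theta x^2, theta x^2} and {theta x, theta x^3}. Comparing the two
    gives R 3 = 2 R 2, and the condition at (theta x, x^3) then yields the factor. With j = n + 3
    this factor is j + 2 l, which is nonzero in the generic case. *)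
Lemma odd_generic_obstruction n :
  (forall f k, gam V true f 1 k = 0) -> (n%:R + 3 + 2 * l) * R 2 n.+2 = 0.
Proof.
move=> V11; have e11 := odd_odd_eq true 1 1 n tV.
have e02 := odd_odd_eq true 0 2 n tV; have e01 := odd_odd_eq true 0 1 n.+1 tV.
have e := odd_even_eq false 0 1 n.+1 tV.
move: e11 e02 e01 e; rewrite !V11 !mulr0 !add0r ?sub0r /lie_coef /= !add0n !add1n !addn1 !addn0.
rewrite -!/(R _ _) -!/(S _ _) -[n.+1%:R]natr1 => e11 e02 e01 e.
have two : 2 != 0 :> K by rewrite pnatr_eq0.
have s3 := congr1 ( *%R 2) e01; have s4 := congr1 ( *%R 2) e02.
rewrite !(mulVKf two) in s3 s4.
have r3 : R 3 n.+1 = 2 * R 2 n.+2.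
  by rewrite s4 -[LHS](mulVKf two) -e11; field.
rewrite -s3 r3 in e.
transitivity (2 * - - (((n%:R + 1) / 2 + l * 1) * R 2 n.+2) + 2 * R 2 n.+2).
  by field.
by rewrite e; field.
Qed.

(** The same four conditions, now with zero at theta x^2: they give R 3 = - R 1, and the last one
    becomes a nonzero multiple of (n + 4) R 1. *)
Lemma odd_special_obstruction n : l = - ((n%:R + 3) / 2) ->
  (forall f k, gam V true f 2 k = 0) -> R 1 n.+3 = 0.
Proof.
move=> hl V12; have e11 := odd_odd_eq true 1 1 n tV.
have e02 := odd_odd_eq true 0 2 n tV; have e01 := odd_odd_eq true 0 1 n.+1 tV.
have e := odd_even_eq false 0 1 n.+1 tV.
move: e11 e02 e01 e; rewrite !V12 !mulr0 ?addr0 ?sub0r /lie_coef /= ?add0n ?add1n ?add2n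
  ?addn1 ?addn0.
rewrite -!/(R _ _) -!/(S _ _) -[n.+1%:R]natr1 => e11 e02 e01 e.
have two : 2 != 0 :> K by rewrite pnatr_eq0.
have s3 := congr1 ( *%R 2) e01; rewrite !(mulVKf two) in s3.
have r3 : R 3 n.+1 = - R 1 n.+3.
  apply/eqP; rewrite -addr_eq0 -[_ + _](mulVKf two) addrC mulrDr e02 -e11.
  by rewrite mulr0.
rewrite -s3 r3 hl in e.
have /eqP : (n.+4%:R) * R 1 n.+3 = 0.
  rewrite -[n.+4]addn4 natrD.
  move/eqP: e; rewrite -subr_eq0 => /eqP/(congr1 ( *%R (- 2))); rewrite mulr0 => <-.
  by field.
by rewrite mulf_eq0 pnatr_eq0 => /eqP.
Qed.

End Odd.

Lemma reduced_zeta_op l m n e : m = l + n%:R + half_parity e ->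
  reduced l m (twisted_coboundary l m (zeta_op n e)).
Proof.
move=> em; have dz := @diffop_zeta_op K n e; split.
  by apply: normal_coboundary => // F; [rewrite zeta_op_dx | rewrite zeta_op_zeta].
move=> f k w; rewrite gam_coboundary_x; last exact: diffop_lin.
rewrite ev_dxn_zeta; case: eqP => [nk|_]; last by rewrite mul0r mulr0.
case: eqP => [ef|_]; last by rewrite mul0r mulr0.
by case: w; rewrite em nk ef; ring.
Qed.

Lemma gam_zeta_op l m n e p f i k : p || (0 < i)%N ->
  (p (+) f = e) -> (i + k + (p && f) = n)%N ->
  gam (twisted_coboundary l m (zeta_op n e)) p f i.+1 k = - (lie_coef l p f i k * n`!%:R).
Proof.
move=> pi he hn; rewrite gam_coboundary //; last exact/diffop_lin/diffop_zeta_op.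
by rewrite ev_dxn_zeta he hn !eqxx mul1r.
Qed.

End Obstructions.

(** * The explicit cocycles *)

Section Cocycles.
Variable K : numFieldType.
Implicit Types (F G H W : superpoly K) (A B : operator K) (U V T : cochain K).
Implicit Types (p q f e r : bool) (l m c : K) (i j n d : nat) (g h k : {poly K}).

(** A twisted cochain of parity r is given by four bilinear maps on ordinary polynomials, one for
    each pair of parities. Being a cocycle then amounts to eight polynomial identities. *)
Definition coefs := bool -> bool -> {poly K} -> {poly K} -> {poly K}.

Definition coefs_cocycle l m r (v : coefs) := forall p q f g h k,
  lie_poly m p (q (+) f (+) r) g (v q f h k)
  - (-1) ^+ (p && q) *: lie_poly m q (p (+) f (+) r) h (v p f g k)
  + v p (q (+) f) g (lie_poly l q f h k)
  - (-1) ^+ (p && q) *: v q (p (+) f) h (lie_poly l p f g k)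
  - v (p (+) q) f (lie_poly (- 1) p q g h) k = 0.

Definition has_coefs U r (v : coefs) := forall p f g h,
  twist_sign (p (+) f) (U (sp p g) (sp f h)) = sp (p (+) f (+) r) (v p f g h).

Lemma has_coefs_twist U r v : is_diffcochain U -> has_coefs U r v ->
  forall p f g h, twist U (sp p g) (sp f h) = sp (p (+) f (+) r) (v p f g h).
Proof. by move=> /diffcochainP[bU _] hv p f g h; rewrite twist_sp. Qed.

Lemma coefs_delta l m U r v : is_diffcochain U -> has_coefs U r v ->
  coefs_cocycle l m r v -> is_cocycle l m U.
Proof.
move=> dU hv cv; apply/cocycle_twist => // p q g h.
have [bU _] := diffcochainP dU; have e := has_coefs_twist dU hv.
apply: (lin_ext (B := fun=> 0)); first exact/lin_delta/bilin_twist.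
  by move=> c F X; rewrite scaler0 addr0.
move=> f k; rewrite /delta !e bracket_sp !lie_sp !e.
rewrite -(sp0 _ (p (+) q (+) f (+) r)) -(cv p q f g h k) !(spD, spN, spZ).
have -> : p (+) (q (+) f (+) r) = p (+) q (+) f (+) r by rewrite !addbA.
have -> : q (+) (p (+) f (+) r) = p (+) q (+) f (+) r.
  by rewrite !addbA [q (+) p]addbC.
have -> : p (+) (q (+) f) (+) r = p (+) q (+) f (+) r by rewrite !addbA.
have -> : q (+) (p (+) f) (+) r = p (+) q (+) f (+) r.
  by rewrite !addbA [q (+) p]addbC.
by [].
Qed.

Lemma coefs_gam U r v p f i (n : nat) : is_diffcochain U -> has_coefs U r v ->
  gam (twist U) p f i n = if p (+) f (+) r then 0 else (v p f 'X^i 'X^n).[0].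
Proof.
move=> dU hv; rewrite /gam /mon (has_coefs_twist dU hv) /ev.
by case: ifP => //; rewrite horner0.
Qed.

(** The polynomial 1 in both parities stands for X_1 and X_theta, so the hypothesis on v is
    normality. *)
Lemma coefs_reduced l m U r v : is_cocycle l m U -> has_coefs U r v ->
  (forall p f h, v p f 1 h = 0) ->
  (forall f n, n%:R + half_parity f <> m - l -> gam (twist U) false f 1 n = 0) ->
  reduced l m (twist U).
Proof.
move=> cU hv v1 gx; have dU := cU.1; have [bU dF] := diffcochainP dU.
split=> //; have [b1 b2] := bilin_twist bU.
have z p : forall F, twist U (sp p 1) F = 0.
  apply: (lin_ext (B := fun=> 0)) => //.
    by move=> c F X; rewrite scaler0 addr0.
  by move=> f h; rewrite (has_coefs_twist dU hv) v1 sp0.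
split=> //; split; [exact: bilin_twist | exact: diffop_twist | exact/cocycle_twist].
Qed.

Definition ups0_coef : coefs := fun p f g h => if p && f then 0 else g^`() * h.

Definition ups12_coef : coefs := fun p f g h =>
  match p, f with
  | false, false => g^`()^`() * h
  | false, true => 0
  | true, false => g^`() * h
  | true, true => - (g^`() * h)
  end.

Definition ups12t_coef : coefs := fun p f g h =>
  match p, f with
  | false, false => (g^`() * h)^`()
  | true, true => 0
  | _, _ => g^`() * h
  end.

Definition ups32_coef : coefs := fun p f g h =>
  match p, f with
  | false, false => g^`()^`()^`() * h
  | false, true => 0
  | true, false => g^`()^`() * h
  | true, true => - (g^`()^`() * h)
  end.

Definition ups32s_coef : coefs := fun p f g h =>
  match p, f with
  | false, false => g^`()^`()^`() * h + 2 *: (g^`()^`() * h^`())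
  | false, true => g^`()^`() * h
  | true, false => g^`()^`() * h + g^`() * h^`()
  | true, true => - (g^`() * h^`())
  end.

Definition ups2_coef l : coefs := fun p f g h =>
  match p, f with
  | false, false => (2 / 3 * l) *: (g^`()^`()^`() * h)
  | false, true => (2 / 3 * l + 1) *: (g^`()^`()^`() * h)
  | true, false => (2 / 3 * l) *: (g^`()^`()^`() * h) - g^`()^`() * h^`()
  | true, true => g^`()^`() * h
  end.

Definition ups52_coef l : coefs := fun p f g h =>
  match p, f with
  | false, false =>
      (2 * l) *: (g^`()^`()^`()^`() * h) - 4 *: (g^`()^`()^`() * h^`())
  | false, true => - (g^`()^`()^`() * h)
  | true, false => (2 * l) *: (g^`()^`()^`() * h) - 3 *: (g^`()^`() * h^`())
  | true, true =>
      3 *: (g^`()^`() * h^`()) - (2 * l + 1) *: (g^`()^`()^`() * h)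
  end.

Definition ups52s_coef : coefs := fun p f g h =>
  match p, f with
  | false, false => 3 *: (g^`()^`()^`() * h^`() + g^`()^`() * h^`()^`())
  | false, true => g^`()^`()^`() * h + 2 *: (g^`()^`() * h^`())
  | true, false => 2 *: (g^`()^`() * h^`()) + g^`() * h^`()^`()
  | true, true => g^`()^`()^`() * h - g^`() * h^`()^`()
  end.

Definition ups3_coef l : coefs := fun p f g h =>
  let a := (2 * l + 1) / 3 in let b := l * (2 * l + 1) / 6 in
  let g2 := g^`()^`() in let g3 := g2^`() in let g4 := g3^`() in
  match p, f with
  | false, false => b *: (g4 * h) - a *: (g3 * h^`())
  | false, true => (a + b) *: (g4 * h) - (a + 1) *: (g3 * h^`())
  | true, false => g2 * h^`()^`() - (2 * a) *: (g3 * h^`()) + b *: (g4 * h)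
  | true, true => a *: (g3 * h) - g2 * h^`()
  end.

Definition ups4_coef l : coefs := fun p f g h =>
  let a := 2 * (l + 1) / 3 in let b := (l + 1) * (2 * l + 1) / 6 in
  let c := l * (l + 1) * (2 * l + 1) / 15 in
  let g2 := g^`()^`() in let g3 := g2^`() in let g4 := g3^`() in
  let g5 := g4^`() in let h1 := h^`() in let h2 := h1^`() in
  match p, f with
  | false, false => (2 * b) *: (g4 * h1) - a *: (g3 * h2) - c *: (g5 * h)
  | false, true =>
      (2 * a + 2 * b) *: (g4 * h1) - (a + 1) *: (g3 * h2) - (b + c) *: (g5 * h)
  | true, false =>
      g2 * h2^`() - (3 * a) *: (g3 * h2) + (3 * b) *: (g4 * h1) - c *: (g5 * h)
  | true, true => (2 * a) *: (g3 * h1) - g2 * h2 - b *: (g4 * h)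
  end.

Ltac coefs_calc :=
  move=> [] [] g h; rewrite ?psignE ?etabarE ?spMl /= ?psignE; congr pair; polyid.

Lemma ups0_coefP : has_coefs Ups0 false ups0_coef.
Proof. by rewrite /Ups0 /ups0_coef; coefs_calc. Qed.
Lemma ups12_coefP : has_coefs Ups12 true ups12_coef.
Proof. by rewrite /Ups12 /ups12_coef; coefs_calc. Qed.
Lemma ups12t_coefP : has_coefs Ups12t true ups12t_coef.
Proof. by rewrite /Ups12t /ups12t_coef; coefs_calc. Qed.
Lemma ups32_coefP : has_coefs Ups32 true ups32_coef.
Proof. by rewrite /Ups32 /ups32_coef; coefs_calc. Qed.
Lemma ups32s_coefP : has_coefs Ups32s true ups32s_coef.
Proof. by rewrite /Ups32s /ups32s_coef; coefs_calc. Qed.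
Lemma ups2_coefP l : has_coefs (Ups2 l) false (ups2_coef l).
Proof. by rewrite /Ups2 /ups2_coef; coefs_calc. Qed.
Lemma ups52_coefP l : has_coefs (Ups52 l) true (ups52_coef l).
Proof. by rewrite /Ups52 /ups52_coef; coefs_calc. Qed.
Lemma ups52s_coefP : has_coefs Ups52s true ups52s_coef.
Proof. by rewrite /Ups52s /ups52s_coef; coefs_calc. Qed.
Lemma ups3_coefP l : has_coefs (Ups3 l) false (ups3_coef l).
Proof. by rewrite /Ups3 /ups3_coef; coefs_calc. Qed.
Lemma ups4_coefP l : has_coefs (Ups4 l) false (ups4_coef l).
Proof. by rewrite /Ups4 /ups4_coef; coefs_calc. Qed.

Lemma etabarM F G : etabar (F * G) = etabar F * G + psign F * etabar G.
Proof.
by case: F G => [a b] [c d]; rewrite psignE !etabarE !spMl; congr pair; polyid.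
Qed.

Ltac diffop_auto := repeat first
  [ exact: diffop_id | exact: diffop_psign | exact: diffop_etabar | exact: diffop_dx
  | exact: diffop_dxn | apply: (diffop_comp (diffop_etabar K))
  | apply: (diffop_comp (diffop_dxn K _)) | apply: (diffop_comp (diffop_dx K))
  | apply: (diffop_comp (diffop_psign K)) ].

Ltac diffcochain_auto := repeat first
  [ apply: diffcochain_add | apply: diffcochain_opp | apply: diffcochain_scale
  | apply: diffcochain_mul; diffop_auto ].

Lemma diffcochain_ups0 : is_diffcochain (@Ups0 K). Proof. by diffcochain_auto. Qed.
Lemma diffcochain_ups12 : is_diffcochain (@Ups12 K). Proof. by diffcochain_auto. Qed.
Lemma diffcochain_ups12t : is_diffcochain (@Ups12t K).
Proof.
(* The Leibniz rule for [etabar] exhibits a sum of products of operators in G and in F. *)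
suff [n [a e]] : is_diffcochain (fun G F : superpoly K =>
    etabar (dx G) * F + psign (dx G) * etabar F).
  by exists n, a => G F; rewrite -e /Ups12t etabarM.
by diffcochain_auto.
Qed.
Lemma diffcochain_ups32 : is_diffcochain (@Ups32 K). Proof. by diffcochain_auto. Qed.
Lemma diffcochain_ups32s : is_diffcochain (@Ups32s K). Proof. by diffcochain_auto. Qed.
Lemma diffcochain_ups2 l : is_diffcochain (Ups2 l). Proof. by diffcochain_auto. Qed.
Lemma diffcochain_ups52 l : is_diffcochain (Ups52 l). Proof. by diffcochain_auto. Qed.
Lemma diffcochain_ups52s : is_diffcochain (@Ups52s K). Proof. by diffcochain_auto. Qed.
Lemma diffcochain_ups3 l : is_diffcochain (Ups3 l). Proof. by diffcochain_auto. Qed.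
Lemma diffcochain_ups4 l : is_diffcochain (Ups4 l). Proof. by diffcochain_auto. Qed.

Ltac cocycle_calc := move=> [] [] [] g h k;
  rewrite /lie_poly /= ?expr0 ?expr1 ?scaleN1r ?scale1r; pjets; subst.

Lemma cocycle_ups0 l : is_cocycle l l Ups0.
Proof.
by apply: (coefs_delta diffcochain_ups0 ups0_coefP); rewrite /ups0_coef; cocycle_calc; field.
Qed.

Lemma cocycle_ups12 l m : l = 0 -> m = 1 / 2 -> is_cocycle l m Ups12.
Proof.
move=> l0 m0; apply: (coefs_delta diffcochain_ups12 ups12_coefP); rewrite /ups12_coef.
by cocycle_calc; field.
Qed.

Lemma cocycle_ups12t l m : l = 0 -> m = 1 / 2 -> is_cocycle l m Ups12t.
Proof.
move=> l0 m0; apply: (coefs_delta diffcochain_ups12t ups12t_coefP); rewrite /ups12t_coef.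
by cocycle_calc; field.
Qed.

Lemma cocycle_ups32 l m : m = l + 3 / 2 -> is_cocycle l m Ups32.
Proof.
move=> m0; apply: (coefs_delta diffcochain_ups32 ups32_coefP); rewrite /ups32_coef.
by cocycle_calc; field.
Qed.

Lemma cocycle_ups32s l m : l = - (1 / 2) -> m = 1 -> is_cocycle l m Ups32s.
Proof.
move=> l0 m0; apply: (coefs_delta diffcochain_ups32s ups32s_coefP); rewrite /ups32s_coef.
by cocycle_calc; field.
Qed.

Lemma cocycle_ups2 l m : m = l + 2 -> is_cocycle l m (Ups2 l).
Proof.
move=> m0; apply: (coefs_delta (diffcochain_ups2 l) (ups2_coefP l)); rewrite /ups2_coef.
by cocycle_calc; field.
Qed.

Lemma cocycle_ups52 l m : m = l + 5 / 2 -> is_cocycle l m (Ups52 l).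
Proof.
move=> m0; apply: (coefs_delta (diffcochain_ups52 l) (ups52_coefP l)); rewrite /ups52_coef.
by cocycle_calc; field.
Qed.

Lemma cocycle_ups52s l m : l = - 1 -> m = 3 / 2 -> is_cocycle l m Ups52s.
Proof.
move=> l0 m0; apply: (coefs_delta diffcochain_ups52s ups52s_coefP); rewrite /ups52s_coef.
by cocycle_calc; field.
Qed.

Lemma cocycle_ups3 l m : m = l + 3 -> l = 0 \/ l = - (5 / 2) -> is_cocycle l m (Ups3 l).
Proof.
move=> m0 l0; apply: (coefs_delta (diffcochain_ups3 l) (ups3_coefP l)); rewrite /ups3_coef.
by case: l0 => l0; cocycle_calc; field.
Qed.

(** An arbitrary root s of 33 covers both signs at once. *)
Lemma cocycle_ups4 l m (s : K) : s ^+ 2 = 33 -> m = l + 4 -> l = (- 7 + s) / 4 ->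
  is_cocycle l m (Ups4 l).
Proof.
move=> r2 m0 l0; apply: (coefs_delta (diffcochain_ups4 l) (ups4_coefP l)); rewrite /ups4_coef.
by cocycle_calc; field: r2.
Qed.

End Cocycles.

(** * Computation of the cohomology *)

Section Cohomology.
Variable K : numFieldType.
Implicit Types (F G H W : superpoly K) (A B : operator K) (U V T : cochain K).
Implicit Types (p q f e : bool) (l m c : K) (j k n d : nat).

(** For given p and i the weight leaves only the position (f0, k0), so one scalar multiple of T
    cancels every value at theta^p x^i. *)
Lemma exists_cancel l m d V T p (i : nat) f0 k0 : m = l + d%:R / 2 -> reduced l m V -> reduced
  l m T ->
  ((i + k0).*2 + p + f0 = d.+2)%N -> gam T p f0 i k0 != 0 ->
  exists c, forall f k, gam (fun G F => V G F - c *: T G F) p f i k = 0.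
Proof.
move=> em rV rT w0 t0; exists (gam V p f0 i k0 / gam T p f0 i k0) => f k.
rewrite gam_lincomb.
have [w|w] := eqVneq ((i + k).*2 + p + f)%N d.+2; last first.
  by rewrite !(weight_nat em _ w) // mulr0 subr0.
have ef : f = f0 by move: w w0; case: (f); case: (f0) => //=; lia.
have ek : k = k0 by move: w w0; rewrite ef; lia.
by rewrite ef ek divfK // subrr.
Qed.

Lemma no_weight l m d V p (i : nat) : m = l + d%:R / 2 -> reduced l m V ->
  (d.+2 < i.*2 + p)%N -> forall f k, gam V p f i k = 0.
Proof. by move=> em rV w f k; apply: (weight_nat em rV); case: f; lia. Qed.

Definition spans l m n (T : 'I_n -> cochain K) := forall V, twisted_cocycle l m V ->
  exists (c : 'I_n -> K) (A : operator K), is_diffop A /\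
    forall G F, V G F = lincomb c T G F + twisted_coboundary l m A G F.

Lemma twisted_cocycle_twist l m U : is_cocycle l m U -> twisted_cocycle l m (twist U).
Proof.
move=> cU; have [bU dU] := diffcochainP cU.1.
by split; [exact: bilin_twist | exact: diffop_twist | exact/(cocycle_twist _ _ cU.1)].
Qed.

Lemma bilin_lincomb n (c : 'I_n -> K) (Y : 'I_n -> cochain K) :
  (forall i, bilin (Y i)) -> bilin (lincomb c Y).
Proof.
by move=> h; split=> X; apply: lin_sum => i; apply: lin_scale;
  [exact: (h i).1 | exact: (h i).2].
Qed.

Lemma twist_lincomb n (c : 'I_n -> K) (Y : 'I_n -> cochain K) : (forall i, bilin (Y i)) ->
  forall G F, twist (lincomb c Y) G F = lincomb c (fun i => twist (Y i)) G F.
Proof.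
move=> h; apply: bilin_ext; first exact/bilin_twist/bilin_lincomb.
  by apply: bilin_lincomb => i; exact: bilin_twist.
move=> p f x y; rewrite twist_sp; last exact: bilin_lincomb.
rewrite /lincomb (lin_sumr (@lin_twist_sign K _)); apply: eq_bigr => i _.
by rewrite (linZ (@lin_twist_sign K _)) twist_sp.
Qed.

Lemma spans_H1 l m n (Y : 'I_n -> cochain K) : (forall i, is_cocycle l m (Y i)) ->
  spans l m (fun i => twist (Y i)) -> H1_spanned l m Y.
Proof.
move=> cY sY; split=> // U cU.
have [c [A [dA e]]] := sY _ (twisted_cocycle_twist cU); exists c.
have bU := (diffcochainP cU.1).1; have bY i := (diffcochainP (cY i).1).1.
have bL := bilin_lincomb c bY.
apply: coboundary_twist dA _.
  by split=> X; apply: lin_add; [exact: bU.1 | apply/lin_opp; exact: bL.1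
    | exact: bU.2 | apply/lin_opp; exact: bL.2].
move=> G F; have -> : twist (fun G F => U G F - lincomb c Y G F) G F =
    twist U G F - twist (lincomb c Y) G F.
  rewrite /twist !sum_bool !(linD (@lin_twist_sign K _)) !(linN (@lin_twist_sign K _)); ring.
by rewrite e twist_lincomb // addrC addKr.
Qed.

Lemma free_H1 l m n (Y : 'I_n -> cochain K) : (forall i, is_cocycle l m (Y i)) ->
  (forall (c : 'I_n -> K) A, lin A ->
     (forall G F, lincomb c (fun i => twist (Y i)) G F = twisted_coboundary l m A G F) ->
     forall i, c i = 0) -> H1_free l m Y.
Proof.
move=> cY fY c cob; have bY i := (diffcochainP (cY i).1).1.
have [A lA e] := twist_coboundary cob; apply: (fY c A lA) => G F.
by rewrite -e twist_lincomb.
Qed.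

Lemma spans_reduced l m n (T : 'I_n -> cochain K) :
  (forall V, reduced l m V -> exists (c : 'I_n -> K) (A : operator K), is_diffop A /\
    forall G F, V G F = lincomb c T G F + twisted_coboundary l m A G F) -> spans l m T.
Proof.
move=> h V tV; have [A dA rA] := reduce tV; have [c [B [dB e]]] := h _ rA.
exists c, (fun F => A F + B F); split; first exact: diffop_add.
move=> G F; have := e G F; rewrite /twisted_coboundary => /eqP; rewrite subr_eq => /eqP ->.
rewrite (linD (@lin_lier K m G)); ring.
Qed.

Lemma lincomb0 (c : 'I_0 -> K) Y G F : lincomb c Y G F = 0.
Proof. by rewrite /lincomb big_ord0. Qed.

Lemma lincomb1 (c : 'I_1 -> K) Y G F : lincomb c Y G F = c ord0 *: Y ord0 G F.
Proof. by rewrite /lincomb big_ord1. Qed.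

Lemma twisted_coboundary_scale l m c A G F : lin A ->
  twisted_coboundary l m (fun F => c *: A F) G F = c *: twisted_coboundary l m A G F.
Proof. by move=> lA; rewrite /twisted_coboundary (linZ (@lin_lier K m G)) !scale_cst; ring. Qed.

Lemma twisted_coboundary0 l m G F : twisted_coboundary l m (fun=> 0) G F = 0.
Proof. by rewrite /twisted_coboundary (lin0 (@lin_lier K m G)) subrr. Qed.

Lemma spans_zeta_op l m k (T : 'I_k -> cochain K) n e : m = l + n%:R + half_parity e ->
  (forall V, reduced l m V -> exists t (c : 'I_k -> K), forall G F,
    V G F - t *: twisted_coboundary l m (zeta_op n e) G F = lincomb c T G F) -> spans l m T.
Proof.
move=> em h; apply: spans_reduced => V rV; have [t [c e1]] := h V rV.
exists c, (fun F => t *: zeta_op n e F); split; first exact/diffop_scale/diffop_zeta_op.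
move=> G F; rewrite twisted_coboundary_scale; last exact/diffop_lin/diffop_zeta_op.
by rewrite -e1 subrK.
Qed.

Lemma odd_half j : (2 * j + 1)%N%:R / 2 = j%:R + 2^-1 :> K.
Proof. by rewrite natrD natrM; field. Qed.

Lemma even_half j : (2 * j)%N%:R / 2 = j%:R :> K.
Proof. by rewrite natrM; field. Qed.

(** At theta x and theta x^(j-1), the coboundary of zeta^(2j) has the nonzero value - j! / 2. The
    values at X_x vanish by [gam_x_eq0]. *)
Lemma even_form l m j V : m = l + j%:R -> (0 < j)%N -> reduced l m V ->
  exists t, let V' := fun G F => V G F - t *: twisted_coboundary l m (zeta_op j false) G F in
   [/\ reduced l m V', forall f k, gam V' false f 1 k = 0
     & forall f k, gam V' true f 1 k = 0].
Proof.
case: j => // j em _ rV.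
have em' : m = l + (2 * j.+1)%N%:R / 2 by rewrite even_half.
have rZ : reduced l m (twisted_coboundary l m (zeta_op j.+1 false)).
  by apply: reduced_zeta_op; rewrite /half_parity addr0.
have z0 : gam (twisted_coboundary l m (zeta_op j.+1 false)) true true 1 j != 0.
  rewrite (@gam_zeta_op _ l m j.+1 false true true 0 j) ?add0n ?addn1 //.
  by rewrite oppr_eq0 mulf_eq0 invr_eq0 !pnatr_eq0 -lt0n fact_gt0.
have [|t ht] := exists_cancel (p := true) (i := 1) (f0 := true) em' rV rZ _ z0; first by lia.
exists t => V'; have rV' := reduced_lincomb t rV rZ; split=> //.
by apply: (gam_x_eq0 em' rV'); lia.
Qed.

(** At theta x and x^j, the coboundary of zeta^(2j+1) has value - (j + 2 l) / 2 times j!. *)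
Lemma odd_form_generic l m j V : m = l + j%:R + 2^-1 -> j%:R + 2 * l != 0 ->
  reduced l m V ->
  exists t, let V' := fun G F => V G F - t *: twisted_coboundary l m (zeta_op j true) G F in
   [/\ reduced l m V', forall f k, gam V' false f 1 k = 0
     & forall f k, gam V' true f 1 k = 0].
Proof.
move=> em l0 rV.
have em' : m = l + (2 * j + 1)%N%:R / 2 by rewrite odd_half addrA.
have rZ : reduced l m (twisted_coboundary l m (zeta_op j true)) by apply: reduced_zeta_op.
have z0 : gam (twisted_coboundary l m (zeta_op j true)) true false 1 j != 0.
  rewrite (@gam_zeta_op _ l m j true true false 0 j) ?add0n ?addn0 //.
  rewrite oppr_eq0 mulf_eq0 pnatr_eq0 negb_or -lt0n fact_gt0 andbT /lie_coef.
  have -> : j%:R / 2 + l * 1 = (j%:R + 2 * l) / 2 by field.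
  by rewrite mulf_eq0 invr_eq0 pnatr_eq0 orbF.
have [|t ht] := exists_cancel (p := true) (i := 1) (f0 := false) em' rV rZ _ z0; first by lia.
exists t => V'; have rV' := reduced_lincomb t rV rZ; split=> //.
apply: (gam_x_eq0 em' rV'); first by lia.
by move=> j0 le; case/eqP: l0; rewrite le mulr0 addr0; have -> : j = 0%N by lia.
Qed.

(** The coboundary of zeta^(2j+1) now vanishes at theta x, but at theta x^2 and x^(j-1) its
    coefficient is (j - 1)/2 + 2 l = - (j + 1)/2 up to sign, which is nonzero. The value at theta
    x^2 is cancelled and those at theta x are untouched. *)
Lemma odd_form_special l m j V : m = l + j%:R + 2^-1 -> j%:R + 2 * l = 0 ->
  (0 < j)%N -> reduced l m V ->
  exists t, let V' := fun G F => V G F - t *: twisted_coboundary l m (zeta_op j true) G F in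
   [/\ reduced l m V', forall f k, gam V' false f 1 k = 0,
       forall f k, gam V' true f 2 k = 0
     & forall f k, gam V' true f 1 k = gam V true f 1 k].
Proof.
case: j => // j em l0 _ rV.
have em' : m = l + (2 * j.+1 + 1)%N%:R / 2 by rewrite odd_half addrA.
have rZ : reduced l m (twisted_coboundary l m (zeta_op j.+1 true)) by apply: reduced_zeta_op.
have z0 : gam (twisted_coboundary l m (zeta_op j.+1 true)) true false 2 j != 0.
  rewrite (@gam_zeta_op _ l m j.+1 true true false 1 j) ?add1n ?addn0 //.
  rewrite oppr_eq0 mulf_eq0 [X in _ || X]pnatr_eq0 negb_or -[X in _ && X]lt0n fact_gt0 andbT
    /lie_coef.
  have -> : j%:R / 2 + l * 2 = - (j.+2%:R / 2).
    have hl : l * 2 = - j.+1%:R by move/eqP: l0; rewrite addr_eq0 mulrC => /eqP ->; rewrite opprK.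
    by rewrite hl -[j.+2]addn2 -[j.+1]addn1 !natrD; field.
  by rewrite oppr_eq0 mulf_eq0 invr_eq0 !pnatr_eq0.
have [|t ht] := exists_cancel (p := true) (i := 2) (f0 := false) em' rV rZ _ z0; first by lia.
exists t => V'; have rV' := reduced_lincomb t rV rZ; split=> //.
  by apply: (gam_x_eq0 em' rV'); lia.
move=> f k; rewrite gam_lincomb; case: (boolP (~~ f && (k == j.+1))) => [/andP[/negPf -> /eqP
  ->]|w].
  rewrite (@gam_zeta_op _ l m j.+1 true true false 0 j.+1) ?add0n ?addn0 // /lie_coef.
  have -> : j.+1%:R / 2 + l * 1 = (j.+1%:R + 2 * l) / 2 by field.
  by rewrite l0 mul0r mul0r oppr0 mulr0 subr0.
rewrite (weight_nat em' rZ) ?mulr0 ?subr0 //.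
by apply/eqP => e; move/negP: w; apply; case: (f) e => /=; lia.
Qed.

Ltac gam_simpl := rewrite ?expr0 ?expr1 /= ?(derivXn, derivX, derivMn, deriv_one, deriv0,
  mul0r, mulr0, scaler0, mul0rn, subr0, addr0, oppr0, horner0, derivM) //=.

Lemma reduced_ups0 l : reduced l l (twist (@Ups0 K)).
Proof.
apply: (coefs_reduced (cocycle_ups0 l) (@ups0_coefP K)); rewrite /ups0_coef.
  by move=> [] [] h; gam_simpl.
move=> [] n; rewrite (coefs_gam _ _ _ _ (@diffcochain_ups0 K) (@ups0_coefP K)) //=.
rewrite subrr /half_parity addr0 /ups0_coef /= expr1 derivX mul1r hornerXn expr0n.
by case: n.
Qed.

Lemma reduced_ups12 l m : l = 0 -> m = 1 / 2 -> reduced l m (twist (@Ups12 K)).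
Proof.
move=> l0 m0; apply: (coefs_reduced (cocycle_ups12 l0 m0) (@ups12_coefP K)); rewrite /ups12_coef.
  by move=> [] [] h; gam_simpl.
by move=> [] n; rewrite (coefs_gam _ _ _ _ (@diffcochain_ups12 K) (@ups12_coefP K)) //= horner0.
Qed.

Lemma reduced_ups12t l m : l = 0 -> m = 1 / 2 -> reduced l m (twist (@Ups12t K)).
Proof.
move=> l0 m0; apply: (coefs_reduced (cocycle_ups12t l0 m0) (@ups12t_coefP K)); rewrite /ups12t_coef.
  by move=> [] [] h; gam_simpl.
move=> [] n; rewrite (coefs_gam _ _ _ _ (@diffcochain_ups12t K) (@ups12t_coefP K)) //=.
rewrite l0 m0 subr0 /half_parity mul1r expr1 derivX mul1r hornerXn expr0n.
by case: n => // -[]; rewrite add0r.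
Qed.

Lemma reduced_ups32 l m : m = l + 3 / 2 -> reduced l m (twist (@Ups32 K)).
Proof.
move=> m0; apply: (coefs_reduced (cocycle_ups32 m0) (@ups32_coefP K)); rewrite /ups32_coef.
  by move=> [] [] h; gam_simpl.
by move=> [] n; rewrite (coefs_gam _ _ _ _ (@diffcochain_ups32 K) (@ups32_coefP K)) //= horner0.
Qed.

Lemma reduced_ups32s l m : l = - (1 / 2) -> m = 1 -> reduced l m (twist (@Ups32s K)).
Proof.
move=> l0 m0; apply: (coefs_reduced (cocycle_ups32s l0 m0) (@ups32s_coefP K)); rewrite /ups32s_coef.
  by move=> [] [] h; gam_simpl.
move=> [] n; rewrite (coefs_gam _ _ _ _ (@diffcochain_ups32s K) (@ups32s_coefP K)) //=.
by move=> _; gam_simpl.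
Qed.

Lemma reduced_ups2 l m : m = l + 2 -> reduced l m (twist (Ups2 l)).
Proof.
move=> m0; apply: (coefs_reduced (cocycle_ups2 m0) (ups2_coefP l)); rewrite /ups2_coef.
  by move=> [] [] h; gam_simpl.
by move=> [] n; rewrite (coefs_gam _ _ _ _ (diffcochain_ups2 l) (ups2_coefP l)) //= => _; gam_simpl.
Qed.

Lemma reduced_ups52 l m : m = l + 5 / 2 -> reduced l m (twist (Ups52 l)).
Proof.
move=> m0; apply: (coefs_reduced (cocycle_ups52 m0) (ups52_coefP l)); rewrite /ups52_coef.
  by move=> [] [] h; gam_simpl.
by move=> [] n; rewrite (coefs_gam _ _ _ _ (diffcochain_ups52 l) (ups52_coefP l)) //= => _;
  gam_simpl.
Qed.

Lemma reduced_ups52s l m : l = - 1 -> m = 3 / 2 -> reduced l m (twist (@Ups52s K)).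
Proof.
move=> l0 m0; apply: (coefs_reduced (cocycle_ups52s l0 m0) (@ups52s_coefP K)); rewrite /ups52s_coef.
  by move=> [] [] h; gam_simpl.
by move=> [] n; rewrite (coefs_gam _ _ _ _ (@diffcochain_ups52s K) (@ups52s_coefP K)) //= => _;
  gam_simpl.
Qed.

Lemma reduced_ups3 l m : is_cocycle l m (Ups3 l) -> reduced l m (twist (Ups3 l)).
Proof.
move=> c3; apply: (coefs_reduced c3 (ups3_coefP l)); rewrite /ups3_coef.
  by move=> [] [] h; gam_simpl.
by move=> [] n; rewrite (coefs_gam _ _ _ _ (diffcochain_ups3 l) (ups3_coefP l)) //= => _; gam_simpl.
Qed.

Lemma reduced_ups4 l m : is_cocycle l m (Ups4 l) -> reduced l m (twist (Ups4 l)).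
Proof.
move=> c4; apply: (coefs_reduced c4 (ups4_coefP l)); rewrite /ups4_coef.
  by move=> [] [] h; gam_simpl.
by move=> [] n; rewrite (coefs_gam _ _ _ _ (diffcochain_ups4 l) (ups4_coefP l)) //= => _; gam_simpl.
Qed.

End Cohomology.

(** * Spanning and freeness detected by one scalar *)

Section Dimensions.
Variable K : numFieldType.
Implicit Types (F G H W : superpoly K) (A B : operator K) (U V T : cochain K).
Implicit Types (p q f e : bool) (l m c : K) (j k n d : nat).

Lemma reduced_vanish l m V : reduced l m V -> (forall f k, gam V false f 1 k = 0) ->
  (forall f k, gam V true f 1 k = 0) -> (forall f k, gam V true f 2 k = 0) ->
  forall G F, V G F = 0.
Proof. by move=> rV h1 h2 h3; apply: (reduced_eq0 rV.1) => f k; split. Qed.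

Lemma spans_zeta_op0 l m j e : (forall V, reduced l m V -> exists t, forall G F,
    V G F - t *: twisted_coboundary l m (zeta_op j e) G F = 0) ->
  spans l m (fun _ : 'I_0 => fun _ _ => 0 : superpoly K).
Proof.
move=> h; apply: spans_reduced => V rV; have [t e0] := h V rV.
exists (fun _ => 0), (fun F => t *: zeta_op j e F); split; first exact/diffop_scale/diffop_zeta_op.
move=> G F; rewrite twisted_coboundary_scale; last exact/diffop_lin/diffop_zeta_op.
by rewrite lincomb0 add0r; apply: subr0_eq.
Qed.

(** The three values of d below solve 2 (i + k) + p + f = d + 2 for x, theta x and theta x^2. If
    none of them occurs, no scalar survives. *)
Lemma spans_none l m : (forall d, m <> l + d%:R / 2) ->
  spans l m (fun _ : 'I_0 => fun _ _ => 0 : superpoly K).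
Proof.
move=> h; apply: spans_reduced => V rV.
exists (fun _ => 0), (fun=> 0); split; first exact: diffop0.
move=> G F; rewrite lincomb0 twisted_coboundary0 addr0; apply: (reduced_vanish rV) => f k.
- apply: rV.2 => e; apply: (h (2 * k + f)%N).
  by rewrite mul2n -addnn !natrD -[LHS](subrK l) -e /half_parity addrC; case: (f); rewrite /=;
    field.
- apply: (reduced_weight rV) => e; apply: (h (2 * k + 1 + f)%N).
  rewrite mul2n -addnn !natrD -[LHS](subrK l) -[m - l](addrK 1) -e /half_parity addrC.
  by case: (f); rewrite /=; field.
- apply: (reduced_weight rV) => e; apply: (h (2 * k + 3 + f)%N).
  rewrite mul2n -addnn !natrD -[LHS](subrK l) -[m - l](addrK 1) -e /half_parity addrC.
  by case: (f); rewrite /=; field.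
Qed.

(** After [even_form] the weight leaves one scalar, at theta x^2 and theta x^(j-2), so one
    obstruction decides. *)
Lemma spans_even0 l m j : m = l + j%:R -> (0 < j)%N ->
  ((1 < j)%N -> forall V, reduced l m V -> (forall f k, gam V true f 1 k = 0) ->
     gam V true true 2 (j - 2) = 0) ->
  spans l m (fun _ : 'I_0 => fun _ _ => 0 : superpoly K).
Proof.
move=> em j0 h; apply: (@spans_zeta_op0 _ _ j false) => V rV.
have [t [r h1 h2]] := even_form em j0 rV; exists t; apply: (reduced_vanish r h1 h2) => f k.
have em' : m = l + (2 * j)%N%:R / 2 by rewrite even_half.
have [w|w] := eqVneq ((2 + k).*2 + true + f)%N (2 * j).+2; last exact: (weight_nat em' r w).
have ef : f = true by case: (f) w => //=; lia.
rewrite ef in w *; have -> : k = (j - 2)%N by lia.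
by apply: h r h2; lia.
Qed.

Lemma spans_odd_generic0 l m j : m = l + j%:R + 2^-1 -> j%:R + 2 * l != 0 ->
  ((0 < j)%N -> forall V, reduced l m V -> (forall f k, gam V true f 1 k = 0) ->
     gam V true false 2 (j - 1) = 0) ->
  spans l m (fun _ : 'I_0 => fun _ _ => 0 : superpoly K).
Proof.
move=> em l0 h; apply: (@spans_zeta_op0 _ _ j true) => V rV.
have [t [r h1 h2]] := odd_form_generic em l0 rV; exists t; apply: (reduced_vanish r h1 h2) => f k.
have em' : m = l + (2 * j + 1)%N%:R / 2 by rewrite odd_half addrA.
have [w|w] := eqVneq ((2 + k).*2 + true + f)%N (2 * j + 1).+2; last exact: (weight_nat em' r w).
have ef : f = false by case: (f) w => //=; lia.
rewrite ef in w *; have -> : k = (j - 1)%N by lia.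
by apply: h r h2; lia.
Qed.

Lemma spans_odd_special0 l m j : m = l + j%:R + 2^-1 -> j%:R + 2 * l = 0 ->
  (2 < j)%N -> spans l m (fun _ : 'I_0 => fun _ _ => 0 : superpoly K).
Proof.
case: j => [|[|[|j]]] // em l0 _; apply: (@spans_zeta_op0 _ _ j.+3 true) => V rV.
have [t [r h1 h2 _]] := odd_form_special em l0 isT rV; exists t;
  apply: (reduced_vanish r h1 _ h2) => f k.
have em' : m = l + (2 * j.+3 + 1)%N%:R / 2 by rewrite odd_half addrA.
have [w|w] := eqVneq ((1 + k).*2 + true + f)%N (2 * j.+3 + 1).+2; last exact: (weight_nat em' r w).
have ef : f = false by case: (f) w => //=; lia.
rewrite ef in w *; have -> : k = j.+3 by lia.
have [tV _ _] := r.1; apply: (odd_special_obstruction tV _ h2).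
by move/eqP: l0; rewrite addrC addr_eq0 -[j.+3]addn3 natrD => /eqP e;
  rewrite -[LHS](mulKf (x := 2)) ?pnatr_eq0 // e; field.
Qed.

Lemma spans_even1 l m j T : m = l + j.+2%:R -> reduced l m T ->
  (forall f k, gam T true f 1 k = 0) -> gam T true true 2 j != 0 ->
  spans l m (fun _ : 'I_1 => T).
Proof.
move=> em rT T1 T2; apply: (@spans_zeta_op _ _ _ _ _ j.+2 false);
  first by rewrite /half_parity addr0.
move=> V rV; have [t [r h1 h2]] := even_form em isT rV; exists t.
have em' : m = l + (2 * j.+2)%N%:R / 2 by rewrite even_half.
have [|c hc] := exists_cancel (p := true) (i := 2) (f0 := true) em' r rT _ T2; first by lia.
exists (fun _ => c) => G F; rewrite lincomb1; apply: subr0_eq.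
apply: (reduced_vanish (reduced_lincomb c r rT) _ _ hc) => f k; rewrite gam_lincomb.
  by rewrite h1 (gam_x_eq0 em' rT) ?mulr0 ?subr0 //; lia.
by rewrite h2 T1 mulr0 subr0.
Qed.

Lemma spans_odd1 l m j T : m = l + j.+1%:R + 2^-1 -> j.+1%:R + 2 * l != 0 ->
  reduced l m T ->
  (forall f k, gam T true f 1 k = 0) -> gam T true false 2 j != 0 ->
  spans l m (fun _ : 'I_1 => T).
Proof.
move=> em l0 rT T1 T2; apply: (@spans_zeta_op _ _ _ _ _ j.+1 true); first by [].
move=> V rV; have [t [r h1 h2]] := odd_form_generic em l0 rV; exists t.
have em' : m = l + (2 * j.+1 + 1)%N%:R / 2 by rewrite odd_half addrA.
have [|c hc] := exists_cancel (p := true) (i := 2) (f0 := false) em' r rT _ T2; first by lia.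
exists (fun _ => c) => G F; rewrite lincomb1; apply: subr0_eq.
apply: (reduced_vanish (reduced_lincomb c r rT) _ _ hc) => f k; rewrite gam_lincomb.
  by rewrite h1 (gam_x_eq0 em' rT) ?mulr0 ?subr0 //; lia.
by rewrite h2 T1 mulr0 subr0.
Qed.

Lemma spans_special1 l m j T : m = l + j.+1%:R + 2^-1 -> j.+1%:R + 2 * l = 0 ->
  reduced l m T -> gam T true false 1 j.+1 != 0 ->
  spans l m (fun _ : 'I_1 => T).
Proof.
move=> em l0 rT T1; apply: (@spans_zeta_op _ _ _ _ _ j.+1 true); first by [].
have em' : m = l + (2 * j.+1 + 1)%N%:R / 2 by rewrite odd_half addrA.
move=> V rV.
have [|c hc] := exists_cancel (p := true) (i := 1) (f0 := false) em' rV rT _ T1; first by lia.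
have rV1 := reduced_lincomb c rV rT.
have [t [r h1 h2 h3]] := odd_form_special em l0 isT rV1.
exists t, (fun _ => c) => G F; rewrite lincomb1; apply: subr0_eq.
rewrite addrAC; apply: (reduced_vanish r h1 _ h2) => f k.
by rewrite h3.
Qed.

Lemma spans_0 l T : reduced l l T -> gam T false false 1 0 != 0 ->
  spans l l (fun _ : 'I_1 => T).
Proof.
move=> rT T1; apply: spans_reduced => V rV.
have em : l = l + 0%N%:R / 2 by rewrite mul0r addr0.
have [|c hc] := exists_cancel (p := false) (i := 1) (f0 := false) em rV rT _ T1; first by [].
have r := reduced_lincomb c rV rT.
exists (fun _ => c), (fun=> 0); split; first exact: diffop0.
move=> G F; rewrite lincomb1 twisted_coboundary0 addr0; apply: subr0_eq.
by apply: (reduced_vanish r hc) => f k; apply: (no_weight em r).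
Qed.

Lemma free1 l m T : (forall c A, lin A ->
    (forall G F, c *: T G F = twisted_coboundary l m A G F) -> c = 0) ->
  forall (c : 'I_1 -> K) A, lin A ->
  (forall G F, lincomb c (fun _ => T) G F = twisted_coboundary l m A G F) -> forall i, c i = 0.
Proof.
move=> h c A lA e i; rewrite ord1; apply: (h _ A lA) => G F.
by rewrite -e lincomb1.
Qed.

Lemma gam_cob_eq l m T c A p f (i : nat) k : lin A -> p || (0 < i)%N ->
  (forall G F, c *: T G F = twisted_coboundary l m A G F) ->
  c * gam T p f i.+1 k = - (lie_coef l p f i k * ev (A (mon (p (+) f) (i + k + (p && f))))).
Proof. by move=> lA pi e; rewrite -(gam_coboundary l m) // /gam -e evZ. Qed.

(** The values of a coboundary at theta x and theta x^2 are both nonzero multiples of the value at 0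
    of A(x^(j+2)). Vanishing at theta x thus forces vanishing at theta x^2. *)
Lemma free_even l m j T : (forall f k, gam T true f 1 k = 0) ->
  gam T true true 2 j != 0 -> forall c A, lin A ->
  (forall G F, c *: T G F = twisted_coboundary l m A G F) -> c = 0.
Proof.
move=> T1 T2 c A lA e.
have e1 := gam_cob_eq true j.+1 lA (isT : true || (0 < 0)%N) e.
have e2 := gam_cob_eq true j lA (isT : true || (0 < 1)%N) e.
move: e1 e2; rewrite /= T1 mulr0 /lie_coef add0n add1n => <- /eqP.
by rewrite mulf_eq0 (negPf T2) orbF => /eqP.
Qed.

(** As in [free_even], with A(theta x^(j+1)); its coefficient at theta x is (j + 1 + 2 l) / 2 up to
    sign. *)
Lemma free_odd l m j T : j.+1%:R + 2 * l != 0 -> (forall f k, gam T true f 1 k = 0) ->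
  gam T true false 2 j != 0 -> forall c A, lin A ->
  (forall G F, c *: T G F = twisted_coboundary l m A G F) -> c = 0.
Proof.
move=> l0 T1 T2 c A lA e.
have e1 := gam_cob_eq false j.+1 lA (isT : true || (0 < 0)%N) e.
have e2 := gam_cob_eq false j lA (isT : true || (0 < 1)%N) e.
move: e1 e2; rewrite /= T1 mulr0 /lie_coef add0n add1n !addn0 => /esym/eqP.
have -> : j.+1%:R / 2 + l * 1 = (j.+1%:R + 2 * l) / 2 by field.
rewrite oppr_eq0 !mulf_eq0 invr_eq0 pnatr_eq0 orbF (negPf l0) => /eqP -> /eqP.
by rewrite mulr0 oppr0 mulf_eq0 (negPf T2) orbF => /eqP.
Qed.

(** Here the coefficient at theta x is zero, so every coboundary vanishes at the position where T
    does not. *)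
Lemma free_special l m j T : j.+1%:R + 2 * l = 0 ->
  gam T true false 1 j.+1 != 0 -> forall c A, lin A ->
  (forall G F, c *: T G F = twisted_coboundary l m A G F) -> c = 0.
Proof.
move=> l0 T1 c A lA e.
have := gam_cob_eq false j.+1 lA (isT : true || (0 < 0)%N) e; rewrite /lie_coef.
have -> : j.+1%:R / 2 + l * 1 = (j.+1%:R + 2 * l) / 2 by field.
by rewrite l0 !mul0r oppr0 => /eqP; rewrite mulf_eq0 (negPf T1) orbF => /eqP.
Qed.

Lemma free_0 l T : gam T false false 1 0 != 0 -> forall c A, lin A ->
  (forall G F, c *: T G F = twisted_coboundary l l A G F) -> c = 0.
Proof.
move=> T1 c A lA e.
have : c * gam T false false 1 0 = 0.
  have -> : c * gam T false false 1 0 = gam (twisted_coboundary l l A) false false 1 0.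
    by rewrite /gam -e evZ.
  by rewrite gam_coboundary_x // /half_parity subrr !subr0 mul0r.
by move/eqP; rewrite mulf_eq0 (negPf T1) orbF => /eqP.
Qed.

End Dimensions.

(** * The cohomology spaces case by case *)

Section MainTheorem.
Variable K : numFieldType.
Implicit Types (Y : cochain K) (A : operator K) (l m c : K).

Lemma tnth1 Y : tnth [tuple Y] = fun=> Y.
Proof. by apply/boolp.funext => i; rewrite ord1. Qed.

Lemma H1_one l m Y : is_cocycle l m Y -> spans l m (fun _ : 'I_1 => twist Y) ->
  (forall c A, lin A -> (forall G F, c *: twist Y G F = twisted_coboundary l m A G F) -> c = 0) ->
  H1_spanned l m (tnth [tuple Y]) /\ H1_dim l m 1.
Proof.
move=> cY sY fY; rewrite tnth1; have sp : H1_spanned l m (fun _ : 'I_1 => Y).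
  by apply: spans_H1.
split=> //; exists (fun _ => Y); split=> //.
by apply: free_H1 => //; exact: free1.
Qed.

Lemma H1_zero l m :
  spans l m (fun _ : 'I_0 => fun _ _ => 0 : superpoly K) -> H1_dim l m 0.
Proof.
move=> s; exists (fun _ => Ups0); split; last by move=> c _ [].
apply: spans_H1 => [[]//|V tV]; have [c [A [dA e]]] := s V tV.
by exists c, A; split=> // G F; rewrite e !lincomb0.
Qed.

Ltac gam_value := rewrite /=
  ?(hornerD, hornerN, hornerZ, hornerM) ?expr0 ?expr1
  ?(derivXn, derivMn, derivX, deriv_one, expr1, deriv0, mul0rn, mulr0, mulr1, mul1r,
    hornerMn, hornerX, horner0, mul0r, mulr0) /= -?polyC1 ?hornerC.

Ltac gam_neq0 := gam_value; rewrite ?(sub0r, subr0, add0r, addr0, oppr_eq0, mulf_eq0,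
  oner_eq0, pnatr_eq0).

Ltac gam_eq0 := gam_value; rewrite ?(mul0r, mulr0, subr0, oppr0, addr0).

Lemma H1_ups0 l : H1_spanned l l (tnth [tuple (@Ups0 K)]) /\ H1_dim l l 1.
Proof.
have v : gam (twist (@Ups0 K)) false false 1 0 != 0.
  by rewrite (coefs_gam _ _ _ _ (@diffcochain_ups0 K) (@ups0_coefP K)) /ups0_coef; gam_neq0.
apply: (H1_one (cocycle_ups0 l) _ (free_0 v)).
exact: spans_0 (reduced_ups0 l) v.
Qed.

Lemma H1_ups32 l m : m = l + 3 / 2 -> l <> - (1 / 2) ->
  H1_spanned l m (tnth [tuple (@Ups32 K)]) /\ H1_dim l m 1.
Proof.
move=> em l0.
have v : gam (twist (@Ups32 K)) true false 2 0 != 0.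
  by rewrite (coefs_gam _ _ _ _ (@diffcochain_ups32 K) (@ups32_coefP K)) /ups32_coef; gam_neq0.
have z f k : gam (twist (@Ups32 K)) true f 1 k = 0.
  by rewrite (coefs_gam _ _ _ _ (@diffcochain_ups32 K) (@ups32_coefP K)) /ups32_coef; case: f;
    gam_eq0.
have l1 : 0.+1%:R + 2 * l != 0.
  apply/eqP => e; apply: l0; apply: subr0_eq.
  by have := congr1 ( *%R 2^-1) e; rewrite mulr0 => <-; field.
apply: (H1_one (cocycle_ups32 em) _ (free_odd l1 z v)).
by apply: (spans_odd1 _ l1 (reduced_ups32 em) z v); rewrite em; field.
Qed.

Lemma H1_ups32s l m : l = - (1 / 2) -> m = 1 ->
  H1_spanned l m (tnth [tuple (@Ups32s K)]) /\ H1_dim l m 1.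
Proof.
move=> el em.
have v : gam (twist (@Ups32s K)) true false 1 1 != 0.
  by rewrite (coefs_gam _ _ _ _ (@diffcochain_ups32s K) (@ups32s_coefP K)) /ups32s_coef; gam_neq0.
have l1 : 0.+1%:R + 2 * l = 0 by rewrite el; field.
apply: (H1_one (cocycle_ups32s el em) _ (free_special l1 v)).
by apply: (spans_special1 _ l1 (reduced_ups32s el em) v); rewrite em el; field.
Qed.

Lemma H1_ups2 l m : m = l + 2 -> H1_spanned l m (tnth [tuple Ups2 l]) /\ H1_dim l m 1.
Proof.
move=> em.
have v : gam (twist (Ups2 l)) true true 2 0 != 0.
  by rewrite (coefs_gam _ _ _ _ (diffcochain_ups2 l) (ups2_coefP l)) /ups2_coef; gam_neq0.
have z f k : gam (twist (Ups2 l)) true f 1 k = 0.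
  by rewrite (coefs_gam _ _ _ _ (diffcochain_ups2 l) (ups2_coefP l)) /ups2_coef; case: f; gam_eq0.
apply: (H1_one (cocycle_ups2 em) _ (free_even z v)).
exact: (spans_even1 em (reduced_ups2 em) z v).
Qed.

Lemma H1_ups52 l m : m = l + 5 / 2 -> l <> - 1 ->
  H1_spanned l m (tnth [tuple Ups52 l]) /\ H1_dim l m 1.
Proof.
move=> em l0.
have v : gam (twist (Ups52 l)) true false 2 1 != 0.
  by rewrite (coefs_gam _ _ _ _ (diffcochain_ups52 l) (ups52_coefP l)) /ups52_coef; gam_neq0.
have z f k : gam (twist (Ups52 l)) true f 1 k = 0.
  by rewrite (coefs_gam _ _ _ _ (diffcochain_ups52 l) (ups52_coefP l)) /ups52_coef; case: f;
    gam_eq0.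
have l1 : 2 + 2 * l != 0.
  apply/eqP => e; apply: l0; apply: subr0_eq.
  by have := congr1 ( *%R 2^-1) e; rewrite mulr0 => <-; field.
apply: (H1_one (cocycle_ups52 em) _ (free_odd l1 z v)).
by apply: (spans_odd1 _ l1 (reduced_ups52 em) z v); rewrite em; field.
Qed.

Lemma H1_ups52s l m : l = - 1 -> m = 3 / 2 ->
  H1_spanned l m (tnth [tuple (@Ups52s K)]) /\ H1_dim l m 1.
Proof.
move=> el em.
have v : gam (twist (@Ups52s K)) true false 1 2 != 0.
  by rewrite (coefs_gam _ _ _ _ (@diffcochain_ups52s K) (@ups52s_coefP K)) /ups52s_coef; gam_neq0.
have l1 : 2 + 2 * l = 0 by rewrite el; field.
apply: (H1_one (cocycle_ups52s el em) _ (free_special l1 v)).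
by apply: (spans_special1 _ l1 (reduced_ups52s el em) v); rewrite em el; field.
Qed.

Lemma H1_ups3 l m : m = l + 3 -> l = 0 \/ l = - (5 / 2) ->
  H1_spanned l m (tnth [tuple Ups3 l]) /\ H1_dim l m 1.
Proof.
move=> em el; have cY := cocycle_ups3 em el.
have v : gam (twist (Ups3 l)) true true 2 1 != 0.
  by rewrite (coefs_gam _ _ _ _ (diffcochain_ups3 l) (ups3_coefP l)) /ups3_coef; gam_neq0.
have z f k : gam (twist (Ups3 l)) true f 1 k = 0.
  by rewrite (coefs_gam _ _ _ _ (diffcochain_ups3 l) (ups3_coefP l)) /ups3_coef; case: f; gam_eq0.
apply: (H1_one cY _ (free_even z v)).
exact: (spans_even1 em (reduced_ups3 cY) z v).
Qed.

Lemma H1_ups4 l m (s : K) : s ^+ 2 = 33 -> m = l + 4 ->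
  l = (- 7 + s) / 4 \/ l = (- 7 - s) / 4 ->
  H1_spanned l m (tnth [tuple Ups4 l]) /\ H1_dim l m 1.
Proof.
move=> s2 em el; have cY : is_cocycle l m (Ups4 l).
  by case: el => el; apply: (cocycle_ups4 _ em el); rewrite ?sqrrN.
have v : gam (twist (Ups4 l)) true true 2 2 != 0.
  by rewrite (coefs_gam _ _ _ _ (diffcochain_ups4 l) (ups4_coefP l)) /ups4_coef; gam_neq0.
have z f k : gam (twist (Ups4 l)) true f 1 k = 0.
  by rewrite (coefs_gam _ _ _ _ (diffcochain_ups4 l) (ups4_coefP l)) /ups4_coef; case: f; gam_eq0.
apply: (H1_one cY _ (free_even z v)).
exact: (spans_even1 em (reduced_ups4 cY) z v).
Qed.

(** For d = 1 and l = 0 coboundaries vanish at both surviving positions, (x, theta) and (theta x,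
    1), so each position carries a class. *)
Lemma H1_ups12 l m : l = 0 -> m = 1 / 2 ->
  H1_spanned l m (tnth [tuple (@Ups12 K); Ups12t]) /\ H1_dim l m 2.
Proof.
move=> l0 em; have em' : m = l + 1%N%:R / 2 by rewrite l0 em add0r.
set Y := tnth _; pose T := twist (@Ups12 K); pose T' := twist (@Ups12t K).
have lY (c : 'I_2 -> K) (Z : 'I_2 -> cochain K) G F :
    lincomb c Z G F = c ord0 *: Z ord0 G F + c ord_max *: Z ord_max G F.
  rewrite /lincomb big_ord_recl big_ord1; congr (_ + c _ *: Z _ _ _);
  exact: val_inj.
have Y0 : Y ord0 = Ups12 by [].
have Y1 : Y ord_max = Ups12t by [].
have cY i : is_cocycle l m (Y i).
  case: i => [[|[|i]] hi] //; rewrite /Y (tnth_nth Ups12) /=.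
    exact: cocycle_ups12.
  exact: cocycle_ups12t.
have rT : reduced l m T by exact: reduced_ups12.
have rT' : reduced l m T' by exact: reduced_ups12t.
have t01 : gam T false true 1 0 = 0.
  by rewrite (coefs_gam _ _ _ _ (@diffcochain_ups12 K) (@ups12_coefP K)) /ups12_coef /= horner0.
have t11 : gam T true false 1 0 != 0.
  by rewrite (coefs_gam _ _ _ _ (@diffcochain_ups12 K) (@ups12_coefP K)) /ups12_coef; gam_neq0.
have t01' : gam T' false true 1 0 != 0.
  by rewrite (coefs_gam _ _ _ _ (@diffcochain_ups12t K) (@ups12t_coefP K)) /ups12t_coef; gam_neq0.
have sY : H1_spanned l m Y.
  apply: spans_H1 => //; apply: spans_reduced => V rV.
  (* [Ups12t] clears the value at x first; [Ups12] vanishes there, so clearing theta x with it does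
     not undo this. *)
  have [|c' hc'] := exists_cancel (p := false) (i := 1) (f0 := true) em' rV rT' _ t01'; first by [].
  have r' := reduced_lincomb c' rV rT'.
  have [|c hc] := exists_cancel (p := true) (i := 1) (f0 := false) em' r' rT _ t11; first by [].
  have r := reduced_lincomb c r' rT.
  exists (fun i => if i == ord0 then c else c'), (fun=> 0); split; first exact: diffop0.
  move=> G F; rewrite twisted_coboundary0 addr0 lY /= Y0 Y1 -/T -/T'.
  apply: subr0_eq; rewrite opprD addrA addrAC; apply: (reduced_vanish r _ hc) => f k.
    rewrite gam_lincomb hc'; suff -> : gam T false f 1 k = 0 by rewrite mulr0 subr0.
    have [w|w] := eqVneq ((1 + k).*2 + false + f)%N 3; last exact: (weight_nat em' rT w).
    by case: f w => w; [have -> : k = 0%N by move: w => /=; lia | move: w => /=; lia].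
  by apply: (no_weight em' r).
split=> //; exists Y; split=> //; apply: free_H1 => // c A lA e.
have {}e G F : c ord0 *: T G F + c ord_max *: T' G F = twisted_coboundary l m A G F.
  by rewrite -e lY Y0 Y1.
have g p f i k : c ord0 * gam T p f i k + c ord_max * gam T' p f i k =
    gam (twisted_coboundary l m A) p f i k.
  by rewrite /gam -e evD !evZ.
have c1 : c ord_max = 0.
  have := g false true 1%N 0%N; rewrite t01 mulr0 add0r gam_coboundary_x //.
  rewrite l0 em /half_parity mul1r !subr0 subrr mul0r => /eqP.
  by rewrite mulf_eq0 (negPf t01') orbF => /eqP.
have c0 : c ord0 = 0.
  have := g true false 1%N 0%N; rewrite c1 mul0r addr0 gam_coboundary //.
  rewrite l0 /lie_coef !mul0r addr0 mul0r oppr0 => /eqP.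
  by rewrite mulf_eq0 (negPf t11) orbF => /eqP.
by case=> [[|[|i]] hi] //; [rewrite -[RHS]c0 | rewrite -[RHS]c1]; congr c; exact: val_inj.
Qed.

Lemma H1_vanish l m (s : K) : s ^+ 2 = 33 ->
  m - l <> 0 -> m - l <> 3 / 2 -> m - l <> 2 -> m - l <> 5 / 2 ->
  (m - l = 3 -> l <> 0 /\ l <> - (5 / 2)) ->
  (m - l = 4 -> l <> (- 7 + s) / 4 /\ l <> (- 7 - s) / 4) ->
  (l = 0 -> m <> 1 / 2) -> H1_dim l m 0.
Proof.
move=> s2 d0 d3 d4 d5 d6 d8 d1; apply: H1_zero.
have [[d em]|nd] := boolp.EM (exists d : nat, m = l + d%:R / 2); last first.
  by apply: spans_none => d em; apply: nd; exists d.
have ml : m - l = d%:R / 2 by rewrite em addrC addKr.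
have two : 2 != 0 :> K by rewrite pnatr_eq0.
have [j [] ej] : exists j, (d = 2 * j)%N \/ (d = 2 * j + 1)%N.
  by exists d./2; rewrite -{1 3}[d]odd_double_half; case: (odd d); [right | left]; lia.
  have em' : m = l + j%:R by rewrite em ej even_half.
  have ml' : m - l = j%:R by rewrite em' addrC addKr.
  case: j em' ml' {ej} => [|[|[|[|[|j]]]]] em' ml'; first by case: d0.
  - exact: (spans_even0 em').
  - by case: d4.
  - apply: (spans_even0 em') => // _ V rV V11; have [tV _ _] := rV.1.
    have := even_obstruction3 tV V11 0; apply: mulf_eq0_cancel; apply/eqP => e.
    have /eqP : l * (2 * l + 5) = 0.
      by have := congr1 ( *%R 2^-1) e; rewrite mulr0 => <-; field.
    rewrite mulf_eq0 => /orP[/eqP l0|/eqP l0]; have [h1 h2] := d6 ml'; first by case: h1.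
    by case: h2; apply: subr0_eq; have := congr1 ( *%R 2^-1) l0; rewrite mulr0 => <-; field.
  - apply: (spans_even0 em') => // _ V rV V11; have [tV _ _] := rV.1.
    have := even_obstruction3 tV V11 1; apply: mulf_eq0_cancel; apply/eqP => e.
    (* Four times the factor of [even_obstruction3] at n = 1 is (4 l + 7)^2 - 33. *)
    have /eqP : (4 * l + 7) ^+ 2 = s ^+ 2.
      by rewrite s2; apply: subr0_eq; have := congr1 ( *%R 4) e; rewrite mulr0 => <-; ring.
    rewrite eqf_sqr => /orP[/eqP l0|/eqP l0]; have [h1 h2] := d8 ml'.
      by case: h1; rewrite -l0; field.
    by case: h2; rewrite -l0; field.
  - apply: (spans_even0 em') => // _ V rV V11; have [tV _ _] := rV.1.
    exact: (even_obstruction5 tV V11).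
have em' : m = l + j%:R + 2^-1 by rewrite em ej odd_half addrA.
have ml' : m - l = j%:R + 2^-1 by rewrite ml ej odd_half.
have [l0|l0] := eqVneq (j%:R + 2 * l) 0.
  case: j em' ml' l0 {ej} => [|[|[|j]]] em' ml' l0.
  - have l00 : l = 0 by apply: (mulfI two); rewrite mulr0 -l0 add0r.
    by case: (d1 l00); rewrite em' l00; field.
  - by case: d3; rewrite ml'; field.
  - by case: d5; rewrite ml'; field.
  - exact: (spans_odd_special0 em' l0).
apply: (spans_odd_generic0 em' l0).
case: j em' ml' l0 {ej} => [|[|[|j]]] em' ml' l0 // _.
- by case: d3; rewrite ml'; field.
- by case: d5; rewrite ml'; field.
move=> V rV V11; have [tV _ _] := rV.1.
have := odd_generic_obstruction tV j V11; apply: mulf_eq0_cancel.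
by rewrite -[j.+3]addn3 natrD in l0.
Qed.

End MainTheorem.

Lemma sqrt33_sqr (R : realType) (k : ground) : sqrt33 R k ^+ 2 = 33.
Proof.
case: k => /=; first by rewrite sqr_sqrtr.
by rewrite -rmorphXn /= sqr_sqrtr // rmorph_nat.
Qed.

Theorem theorem4p6 (R : realType) (k : ground) (lambda mu : ground_field R k) :
  let special3 := lambda = 0 \/ lambda = - (5 / 2) in
  let special4 := lambda = (- 7 + sqrt33 R k) / 4 \/
                  lambda = (- 7 - sqrt33 R k) / 4 in
  let dim1_case :=
    mu - lambda = 0 \/ mu - lambda = 3 / 2 \/ mu - lambda = 2 \/
    mu - lambda = 5 / 2 \/ (mu - lambda = 3 /\ special3) \/
    (mu - lambda = 4 /\ special4) in
  let dim2_case := lambda = 0 /\ mu = 1 / 2 in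
  ((dim1_case -> H1_dim lambda mu 1) /\
   (dim2_case -> H1_dim lambda mu 2) /\
   (~ dim1_case -> ~ dim2_case -> H1_dim lambda mu 0))
  /\
  ((mu = lambda -> H1_spanned lambda mu (tnth [tuple Ups0])) /\
   (lambda = 0 -> mu = 1 / 2 ->
      H1_spanned lambda mu (tnth [tuple Ups12; Ups12t])) /\
   (mu = lambda + 3 / 2 -> lambda <> - (1 / 2) ->
      H1_spanned lambda mu (tnth [tuple Ups32])) /\
   (lambda = - (1 / 2) -> mu = 1 ->
      H1_spanned lambda mu (tnth [tuple Ups32s])) /\
   (mu = lambda + 2 -> H1_spanned lambda mu (tnth [tuple Ups2 lambda])) /\
   (mu = lambda + 5 / 2 -> lambda <> - 1 ->
      H1_spanned lambda mu (tnth [tuple Ups52 lambda])) /\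
   (lambda = - 1 -> mu = 3 / 2 ->
      H1_spanned lambda mu (tnth [tuple Ups52s])) /\
   (mu = lambda + 3 -> special3 ->
      H1_spanned lambda mu (tnth [tuple Ups3 lambda])) /\
   (mu = lambda + 4 -> special4 ->
      H1_spanned lambda mu (tnth [tuple Ups4 lambda]))).
Proof.
move=> special3 special4 dim1_case dim2_case.
have s2 := sqrt33_sqr R k.
have sub_eq (c : ground_field R k) : mu - lambda = c -> mu = lambda + c.
  by move=> <-; rewrite addrC subrK.
split; last first.
  split; first by move=> ->; exact: (H1_ups0 lambda).1.
  split; first by move=> h1 h2; exact: (H1_ups12 h1 h2).1.
  split; first by move=> h1 h2; exact: (H1_ups32 h1 h2).1.
  split; first by move=> h1 h2; exact: (H1_ups32s h1 h2).1.
  split; first by move=> h1; exact: (H1_ups2 h1).1.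
  split; first by move=> h1 h2; exact: (H1_ups52 h1 h2).1.
  split; first by move=> h1 h2; exact: (H1_ups52s h1 h2).1.
  split; first by move=> h1 h2; exact: (H1_ups3 h1 h2).1.
  by move=> h1 h2; exact: (H1_ups4 s2 h1 h2).1.
split; last split.
- case=> [/sub_eq em|[/sub_eq em|[/sub_eq em|[/sub_eq em|[[/sub_eq em h]|[/sub_eq em h]]]]]].
  + by rewrite em addr0; exact: (H1_ups0 lambda).2.
  (* At this lambda, j + 2 lambda = 0 with j = 1, so the generic cocycle gives way to the special
     one. *)
  + have [l0|l0] := eqVneq lambda (- (1 / 2)); last exact: (H1_ups32 em (elimN eqP l0)).2.
    by apply: (H1_ups32s l0 _).2; rewrite em l0; field.
  + exact: (H1_ups2 em).2.
  + have [l0|l0] := eqVneq lambda (- 1); last exact: (H1_ups52 em (elimN eqP l0)).2.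
    by apply: (H1_ups52s l0 _).2; rewrite em l0; field.
  + exact: (H1_ups3 em h).2.
  + exact: (H1_ups4 s2 em h).2.
- by case=> h1 h2; exact: (H1_ups12 h1 h2).2.
move=> n1 n2; apply: (H1_vanish s2).
- by move=> h; apply: n1; left.
- by move=> h; apply: n1; right; left.
- by move=> h; apply: n1; do 2 right; left.
- by move=> h; apply: n1; do 3 right; left.
- by move=> h; split=> h'; apply: n1; do 4 right; left; split=> //; [left | right].
- by move=> h; split=> h'; apply: n1; do 5 right; split=> //; [left | right].
- by move=> h1 h2; apply: n2.
Qed.
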